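(* Let $A$ be a tabular algebra of finite rank, with trace and with table datum $(\Lambda,\Gamma,B,M,C,* )$. Let $k:=\mathbb{Q}(v)$ and $\mathcal{A}=\mathbb{Z}[v,v^{-1}]$. (i) For any $\lambda\in\Lambda$, $A_\lambda^\infty\cong M_{|M(\lambda)|}(\mathbb{Z})\otimes_{\mathbb{Z}}\Gamma(\lambda)$ as $\mathbb{Z}$-algebras, where $M_n(\mathbb{Z})$ denotes the ring of $n\times n$ integer matrices. (ii) There are $k$-algebra isomorphisms $$k\otimes_{\mathcal{A}}A\;\cong\;k\otimes_{\mathbb{Z}}A^\infty\;\cong\;\bigoplus_{\lambda\in\Lambda}\bigl(k\otimes_{\mathbb{Z}}M_{|M(\lambda)|}(\mathbb{Z})\otimes_{\mathbb{Z}}\Gamma(\lambda)\bigr).$$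
   Context: **Normalized table algebras.** A normalized table algebra over $\mathbb{Z}$ is a pair $(\Gamma,B)$, where $\Gamma$ is an associative unital $\mathbb{Z}$-algebra (possibly noncommutative or of infinite rank) and $B$ is a $\mathbb{Z}$-basis of $\Gamma$ with $1\in B$, such that: (T1) the structure constants of $\Gamma$ with respect to $B$ are nonnegative integers; (T2) there is a linear algebra anti-automorphism $\bar{\ }$ of $\Gamma$ with square the identity and $\overline{B}=B$; (T3) writing $\kappa(b,a)$ for the coefficient of $b\in B$ in $a\in\Gamma$, one has $\kappa(b'',bb')=\kappa(b,b''\,\overline{b'})$ for all $b,b',b''\in B$. Write $\mathrm{supp}(a)=\{b\in B:\kappa(b,a)\neq0\}$. **Tabular algebras.** Let $\mathcal{A}=\mathbb{Z}[v,v^{-1}]$. A tabular algebra is an $\mathcal{A}$-algebra $A$ with a table datum $(\Lambda,\Gamma,B,M,C,* )$ where: (A1) $\Lambda$ is a finite poset. For each $\lambda\in\Lambda$, $(\Gamma(\lambda),B(\lambda))$ is a normalized table algebra over $\mathbb{Z}$ and $M(\lambda)$ is a finite set. The map $C:\coprod_{\lambda\in\Lambda}(M(\lambda)\times B(\lambda)\times M(\lambda))\to A$ is injective with image an $\mathcal{A}$-basis of $A$. The image $\mathrm{Im}(C)$ contains a set of mutually orthogonal idempotents $\{1_\varepsilon:\varepsilon\in\mathcal{E}\}$ such that $A=\sum_{\varepsilon,\varepsilon'}1_\varepsilon A1_{\varepsilon'}$ and each $X\in\mathrm{Im}(C)$ satisfies $X=1_\varepsilon X1_{\varepsilon'}$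 for some $\varepsilon,\varepsilon'\in\mathcal{E}$. (A2) Write $C_{S,T}^b=C(S,b,T)$ for $S,T\in M(\lambda)$, $b\in B(\lambda)$. Then $*$ is an $\mathcal{A}$-linear involutory anti-automorphism of $A$ with $(C_{S,T}^b)^*=C_{T,S}^{\overline{b}}$. If $g=\sum_ic_ib_i$ with $b_i\in B(\lambda)$ and scalars $c_i$ (possibly involving $v$), $C_{S,T}^g$ denotes $\sum_ic_iC_{S,T}^{b_i}$. Write $\mathbf{c}_\lambda=C(M(\lambda)\times B(\lambda)\times M(\lambda))$. (A3) If $\lambda\in\Lambda$, $g\in\Gamma(\lambda)$, $S,T\in M(\lambda)$, then for all $a\in A$, $a\,C_{S,T}^g\equiv\sum_{S'\in M(\lambda)}C_{S',T}^{r_a(S',S)g}\bmod A(<\lambda)$, where $r_a(S',S)\in\mathcal{A}\otimes_{\mathbb{Z}}\Gamma(\lambda)$ is independent of $T$ and $g$, and $A(<\lambda)$ is the $\mathcal{A}$-span of $\bigcup_{\mu<\lambda}\mathbf{c}_\mu$. **The $\mathbf a$-function.** For $X,Y\in\mathrm{Im}(C)$ write $XY=\sum_{Z\in\mathrm{Im}(C)}g_{X,Y,Z}Z$. For $Z\in\mathrm{Im}(C)$ put $\mathbf{a}(Z)=\max_{X,Y\in\mathrm{Im}(C)}\deg(g_{X,Y,Z})$, where the degree of a Laurent polynomial is the highest power of $v$ occurring with nonzero coefficient. Let $\gamma_{X,Y,Z}\in\mathbb{Z}$ be the coefficient of $v^{\mathbf{a}(Z)}$ in $g_{X,Y,Z}$.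 **Tabular algebra with trace.** A tabular algebra which also satisfies: (A4) Let $K=C_{S,T}^b$, $K'=C_{U,V}^{b'}$, $K''=C_{X,Y}^{b''}$ lie in $\mathrm{Im}(C)$. Then the bound $\deg(g_{K,K',K''})=\mathbf{a}(K'')$ is achieved if and only if $X=S$, $T=U$, $Y=V$ and $b''\in\mathrm{supp}(bb')$. If these conditions all hold and furthermore $b=b'=b''=1$, then $\gamma_{K,K',K''}=1$. (A5) There is an $\mathcal{A}$-linear map $\tau:A\to\mathcal{A}$ (the tabular trace) with $\tau(x)=\tau(x^* )$ and $\tau(xy)=\tau(yx)$ for all $x,y\in A$, such that for every $\lambda\in\Lambda$, $S,T\in M(\lambda)$, $b\in B(\lambda)$ and $X=C_{S,T}^b$, $\tau(v^{\mathbf{a}(X)}X)\equiv1\bmod v^{-1}\mathcal{A}^-$ if $S=T$ and $b=1$, and $\equiv0\bmod v^{-1}\mathcal{A}^-$ otherwise, where $\mathcal{A}^-=\mathbb{Z}[v^{-1}]$. **Asymptotic algebras.** For $\lambda\in\Lambda$, $A_\lambda$ is the $\mathcal{A}$-submodule of $A$ spanned by $\mathbf{c}_\lambda$, with the associative multiplication $XX'=\sum_{X''\in\mathbf{c}_\lambda}g_{X,X',X''}X''$ for $X,X'\in\mathbf{c}_\lambda$. For $X\in\mathrm{Im}(C)$ put $\widehat{X}=v^{-\mathbf{a}(X)}X$. Let $A_\lambda^-$ be the $\mathcal{A}^-$-submodule of $A_\lambda$ generated by $\{\widehat{X}:X\in\mathbf{c}_\lambda\}$ (for a tabular algebra with trace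 it is closed under the multiplication of $A_\lambda$), and $A_\lambda^\infty:=A_\lambda^-/v^{-1}A_\lambda^-$. Writing $t_X$ for the image of $\widehat{X}$, $A_\lambda^\infty$ is a $\mathbb{Z}$-algebra with $\mathbb{Z}$-basis $\{t_X:X\in\mathbf{c}_\lambda\}$ and multiplication $t_Xt_{X'}=\sum_{X''\in\mathbf{c}_\lambda}\gamma_{X,X',X''}t_{X''}$. Finally $A^\infty:=\bigoplus_{\lambda\in\Lambda}A_\lambda^\infty$. *)

(* Defs.v *)
From HB Require Import structures.
From mathcomp Require Import all_boot all_order all_algebra.
From mathcomp Require Import generic_quotient ring_quotient boolp.
From mathcomp Require Import finmap monalg.

Set Implicit Arguments.
Unset Strict Implicit.
Unset Printing Implicit Defensive.

Import Order.TTheory GRing.Theory Num.Theory.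

Local Open Scope ring_scope.
Local Open Scope quotient_scope.

(* In multinomials, {malg R[K]} is the group of finitely supported functions
   K -> R, with coefficients c@_k, support msupp c and point masses
   << r *g k >>.  Its ring structure is only provided for conical monoids K,
   which excludes (int, +), so convolution along a binary operation on K is
   defined here. *)
Section Convolution.
Variables (R : nzRingType) (K : choiceType) (op : K -> K -> K).

Definition conv (f g : {malg R[K]}) : {malg R[K]} :=
  \sum_(i <- msupp f) \sum_(j <- msupp g) << f@_i * g@_j *g op i j >>.

Lemma convE (d1 d2 : {fset K}) f g :
  (msupp f `<=` d1)%fset -> (msupp g `<=` d2)%fset ->
  conv f g = \sum_(i <- d1) \sum_(j <- d2) << f@_i * g@_j *g op i j >>.
Proof.
move=> le_d1 le_d2; rewrite /conv (big_fset_incl _ le_d1) /=.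
  apply/eq_bigr=> i _; apply/big_fset_incl => // j _ /mcoeff_outdom ->.
  by rewrite mulr0 monalgU0.
move=> i _ /mcoeff_outdom fi.
by rewrite big1 => // j _; rewrite fi mul0r monalgU0.
Qed.

Lemma convDl : left_distributive conv +%R.
Proof.
move=> f g h.
rewrite [in RHS](convE (fsubsetUl _ (msupp g)) (fsubset_refl _)).
rewrite [in RHS](convE (fsubsetUr (msupp f) _) (fsubset_refl _)).
rewrite (convE (msuppD_le _ _) (fsubset_refl _)).
rewrite -big_split /=; apply/eq_bigr=> i _.
rewrite -big_split /=; apply/eq_bigr=> j _.
by rewrite mcoeffD mulrDl monalgUD.
Qed.

Lemma convDr : right_distributive conv +%R.
Proof.
move=> f g h.
rewrite [in RHS](convE (fsubset_refl _) (fsubsetUl _ (msupp h))).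
rewrite [in RHS](convE (fsubset_refl _) (fsubsetUr (msupp g) _)).
rewrite (convE (fsubset_refl _) (msuppD_le _ _)).
rewrite -big_split /=; apply/eq_bigr=> i _.
rewrite -big_split /=; apply/eq_bigr=> j _.
by rewrite mcoeffD mulrDr monalgUD.
Qed.

Lemma conv0l f : conv 0 f = 0.
Proof. by rewrite /conv msupp0 big_seq_fset0. Qed.

Lemma conv0r f : conv f 0 = 0.
Proof. by apply: (addrI (conv f 0)); rewrite -convDr !addr0. Qed.

Lemma convUU a b i j : conv << a *g i >> << b *g j >> = << a * b *g op i j >>.
Proof.
by rewrite (convE msuppU_le msuppU_le) !big_seq_fset1 !mcoeffUU.
Qed.

Lemma conv_suml I (r : seq I) (F : I -> {malg R[K]}) g :
  conv (\sum_(i <- r) F i) g = \sum_(i <- r) conv (F i) g.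
Proof. exact: (big_morph (conv^~ g) (fun _ _ => convDl _ _ _) (conv0l g)). Qed.

Lemma conv_sumr I (r : seq I) (F : I -> {malg R[K]}) f :
  conv f (\sum_(i <- r) F i) = \sum_(i <- r) conv f (F i).
Proof. exact: (big_morph (conv f) (fun _ _ => convDr _ _ _) (conv0r f)). Qed.

End Convolution.

Section PushForward.
Variables (R : nzRingType) (K : choiceType) (h : K -> K).

Definition malg_push (f : {malg R[K]}) : {malg R[K]} :=
  \sum_(x <- msupp f) << f@_x *g h x >>.

Lemma malg_pushE (d : {fset K}) f :
  (msupp f `<=` d)%fset -> malg_push f = \sum_(x <- d) << f@_x *g h x >>.
Proof.
move=> le_d; rewrite /malg_push (big_fset_incl _ le_d) //= => x _.
by move/mcoeff_outdom => ->; rewrite monalgU0.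
Qed.

Lemma malg_pushD : {morph malg_push : f g / f + g}.
Proof.
move=> f g; rewrite (malg_pushE (msuppD_le f g)).
rewrite (malg_pushE (fsubsetUl _ (msupp g))).
rewrite (malg_pushE (fsubsetUr (msupp f) _)) -big_split /=.
by apply/eq_bigr => x _; rewrite mcoeffD monalgUD.
Qed.

Lemma malg_pushB : {morph malg_push : f g / f - g}.
Proof.
move=> f g; apply: (addIr (malg_push g)).
by rewrite -malg_pushD !subrK.
Qed.

Lemma malg_push0 : malg_push 0 = 0.
Proof. by rewrite -[X in malg_push X](subrr 0) malg_pushB subrr. Qed.

Lemma malg_pushU a x : malg_push << a *g x >> = << a *g h x >>.
Proof. by rewrite (malg_pushE msuppU_le) big_seq_fset1 mcoeffUU. Qed.

End PushForward.

Lemma malg_indU (R : nzRingType) (K : choiceType) (P : {malg R[K]} -> Prop) :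
  P 0 -> (forall f g, P f -> P g -> P (f + g)) ->
  (forall a i, P << a *g i >>) -> forall f, P f.
Proof. by move=> P0 PD PU f; rewrite [f]monalgE; apply: big_ind. Qed.

Definition laurent : Type := {malg int[int]}.

HB.instance Definition _ := GRing.Zmodule.on laurent.

Section LaurentRing.

Definition laurent_mul : laurent -> laurent -> laurent := conv +%R.
Definition laurent_one : laurent := << 1 *g 0 >>.

Lemma laurent_mulC : commutative laurent_mul.
Proof.
move=> f g; rewrite /laurent_mul /conv exchange_big /=; apply/eq_bigr=> j _.
by apply/eq_bigr=> i _; rewrite mulrC addrC.
Qed.

Lemma laurent_mulA : associative laurent_mul.
Proof.
rewrite /laurent_mul => f g h.
elim/malg_indU: f => [|f1 f2 e1 e2|a i]; first by rewrite !conv0l.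
  by rewrite !convDl e1 e2.
elim/malg_indU: g => [|g1 g2 e1 e2|b j]; first by rewrite conv0r !conv0l conv0r.
  by rewrite convDl !convDr convDl e1 e2.
elim/malg_indU: h => [|h1 h2 e1 e2|c k]; first by rewrite !conv0r.
  by rewrite !convDr e1 e2.
by rewrite !convUU mulrA addrA.
Qed.

Lemma laurent_mul1 : left_id laurent_one laurent_mul.
Proof.
move=> f; elim/malg_indU: f => [|f1 f2 e1 e2|a i]; first exact: conv0r.
  by rewrite /laurent_mul convDr -!/(laurent_mul _ _) e1 e2.
by rewrite /laurent_mul convUU mul1r add0r.
Qed.

Lemma laurent_mulDl : left_distributive laurent_mul +%R.
Proof. exact: convDl. Qed.

Lemma laurent_one_neq0 : laurent_one != 0.
Proof. by rewrite monalgU_eq0 oner_eq0. Qed.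

HB.instance Definition _ := GRing.Zmodule_isComNzRing.Build laurent
  laurent_mulA laurent_mulC laurent_mul1 laurent_mulDl laurent_one_neq0.

End LaurentRing.

Definition lcoef (p : laurent) (n : int) : int := mcoeff n p.

Definition vpow (n : int) : laurent := << 1 *g n >>.

(* The zero polynomial has no degree. *)
Definition has_degree (p : laurent) (n : int) : Prop :=
  lcoef p n != 0 /\ forall m, n < m -> lcoef p m = 0.

(* Z[v^-1] *)
Definition laurent_minus (p : laurent) : Prop :=
  forall m : int, 0 < m -> lcoef p m = 0.

Definition Qv : fieldType := {fraction {poly rat}}.
Definition Qv_v : Qv := tofrac 'X.
Definition laurent_Qv (p : laurent) : Qv :=
  \sum_(m <- msupp p) (lcoef p m)%:~R * Qv_v ^ m.

(* A module together with a product.  The axioms are stated separately so that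
   products on quotients can be defined by lifting representatives. *)
Record alg (R : nzRingType) := Alg {
  alg_mod :> lmodType R;
  amul : alg_mod -> alg_mod -> alg_mod }.

(* No unit is required: tabular algebras are only locally unital. *)
Record assoc_alg_axioms (R : nzRingType) (X : alg R) : Prop := {
  _ : associative (@amul R X);
  _ : left_distributive (@amul R X) +%R;
  _ : right_distributive (@amul R X) +%R;
  _ : forall (c : R) (x y : X), amul (c *: x) y = c *: amul x y;
  _ : forall (c : R) (x y : X), amul x (c *: y) = c *: amul x y }.

Definition alg_iso (R : nzRingType) (X Y : alg R) : Prop :=
  exists f : {linear X -> Y}, bijective f /\ {morph f : x y / amul x y}.

Definition regular_alg (k : fieldType) : alg k := @Alg k k^o *%R.

Definition int_alg (G : pzRingType) : alg int :=
  @Alg int (zmodule G) (fun x y : G => x * y).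

Definition matrix_alg (n : nat) : alg int := @Alg int 'M[int]_n mulmx.

Section DirectSum.
Variables (R : nzRingType) (L : finType).

Definition dsum_type (V : L -> lmodType R) : Type := {dffun forall i, V i}.

Section Module.
Variable V : L -> lmodType R.
Local Notation T := (dsum_type V).

HB.instance Definition _ := Choice.on T.

Definition dsum_zero : T := [ffun i => 0 : V i].
Definition dsum_opp (f : T) : T := [ffun i => - f i].
Definition dsum_add (f g : T) : T := [ffun i => f i + g i].
Definition dsum_scale (c : R) (f : T) : T := [ffun i => c *: f i].

Lemma dsum_addA : associative dsum_add.
Proof. by move=> f g h; apply/ffunP => i; rewrite !ffunE addrA. Qed.
Lemma dsum_addC : commutative dsum_add.
Proof. by move=> f g; apply/ffunP => i; rewrite !ffunE addrC. Qed.
Lemma dsum_add0 : left_id dsum_zero dsum_add.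
Proof. by move=> f; apply/ffunP => i; rewrite !ffunE add0r. Qed.
Lemma dsum_addN : left_inverse dsum_zero dsum_opp dsum_add.
Proof. by move=> f; apply/ffunP => i; rewrite !ffunE addNr. Qed.

HB.instance Definition _ := GRing.isZmodule.Build T
  dsum_addA dsum_addC dsum_add0 dsum_addN.

Lemma dsum_scaleA c d f : dsum_scale c (dsum_scale d f) = dsum_scale (c * d) f.
Proof. by apply/ffunP => i; rewrite !ffunE scalerA. Qed.
Lemma dsum_scale1 : left_id 1 dsum_scale.
Proof. by move=> f; apply/ffunP => i; rewrite !ffunE scale1r. Qed.
Lemma dsum_scaleDr : right_distributive dsum_scale +%R.
Proof. by move=> c f g; apply/ffunP => i; rewrite !ffunE scalerDr. Qed.
Lemma dsum_scaleDl f : {morph dsum_scale^~ f : c d / c + d}.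
Proof. by move=> c d; apply/ffunP => i; rewrite !ffunE scalerDl. Qed.

HB.instance Definition _ := GRing.Zmodule_isLmodule.Build R T
  dsum_scaleA dsum_scale1 dsum_scaleDr dsum_scaleDl.

End Module.

Definition dsum (X : L -> alg R) : alg R :=
  @Alg R (dsum_type X) (fun f g => [ffun i => amul (f i) (g i)]).

End DirectSum.

(* V (x)_R W, where V is an S-module regarded as an R-module along phi : R -> S,
   constructed as an S-module: the free abelian group on V * W modulo the
   subgroup generated by the usual relators. *)
Section Tensor.
Variables (R : nzRingType) (S : comNzRingType) (phi : R -> S).

Section Module.
Variables (V : lmodType S) (W : lmodType R).

Local Notation tfree := {malg int[(V * W)%type]}.

Definition tgen (v : V) (w : W) : tfree := << 1 *g (v, w) >>.

Inductive tensor_rel : tfree -> Prop :=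
| TensorRel0 : tensor_rel 0
| TensorRelB x y : tensor_rel x -> tensor_rel y -> tensor_rel (x - y)
| TensorRelDl v v' w : tensor_rel (tgen (v + v') w - tgen v w - tgen v' w)
| TensorRelDr v w w' : tensor_rel (tgen v (w + w') - tgen v w - tgen v w')
| TensorRelZ r v w : tensor_rel (tgen (phi r *: v) w - tgen v (r *: w)).

Definition tensor_sub : {pred tfree} := fun x => `[< tensor_rel x >].

Lemma tensor_subP : zmod_closed tensor_sub.
Proof.
split; first exact/asboolP/TensorRel0.
by move=> x y /asboolP hx /asboolP hy; exact/asboolP/TensorRelB.
Qed.

HB.instance Definition _ := GRing.isZmodClosed.Build tfree tensor_sub
  tensor_subP.

Definition tensor_type : Type := {ideal_quot tensor_sub}.
HB.instance Definition _ := GRing.Zmodule.on tensor_type.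
HB.instance Definition _ := EqQuotient.on tensor_type.

Definition tfree_scale (s : S) : tfree -> tfree :=
  malg_push (fun x : V * W => (s *: x.1, x.2)).

Lemma tfree_scale_gen s v w : tfree_scale s (tgen v w) = tgen (s *: v) w.
Proof. exact: malg_pushU. Qed.

Lemma tfree_scale_rel s x : tensor_rel x -> tensor_rel (tfree_scale s x).
Proof.
elim=> [|y z _ hy _ hz|v v' w|v w w'|r v w].
- by rewrite /tfree_scale malg_push0; exact: TensorRel0.
- by rewrite /tfree_scale malg_pushB; exact: TensorRelB.
- by rewrite /tfree_scale !malg_pushB -!/(tfree_scale _ _) !tfree_scale_gen
    scalerDr; exact: TensorRelDl.
- by rewrite /tfree_scale !malg_pushB -!/(tfree_scale _ _) !tfree_scale_gen;
    exact: TensorRelDr.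
- rewrite /tfree_scale !malg_pushB -!/(tfree_scale _ _) !tfree_scale_gen.
  by rewrite scalerA mulrC -scalerA; exact: TensorRelZ.
Qed.

Definition tensor_scale (s : S) : tensor_type -> tensor_type :=
  lift_op1 tensor_type (tfree_scale s).

Lemma pi_tensor_scale s :
  {morph \pi_tensor_type : x / tfree_scale s x >-> tensor_scale s x}.
Proof.
move=> x; unlock tensor_scale; apply/eqP.
rewrite -Quotient.idealrBE /tfree_scale -malg_pushB -/(tfree_scale s _).
have : x - repr (\pi_tensor_type x) \in tensor_sub.
  by rewrite Quotient.idealrBE reprK.
by move=> /asboolP/tfree_scale_rel h; apply/asboolP; exact: h.
Qed.

Lemma pi_tensorD (x y : tfree) :
  \pi_tensor_type (x + y) = \pi_tensor_type x + \pi_tensor_type y.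
Proof. exact: (raddfD \pi_tensor_type). Qed.

Lemma tensor_scaleA s t x :
  tensor_scale s (tensor_scale t x) = tensor_scale (s * t) x.
Proof.
rewrite -[x]reprK -!pi_tensor_scale; congr \pi.
elim/malg_indU: (repr x) => [|f g e1 e2|a [v w]].
- by rewrite /tfree_scale !malg_push0.
- by rewrite /tfree_scale !malg_pushD -!/(tfree_scale _ _) e1 e2.
- by rewrite /tfree_scale !malg_pushU /= scalerA.
Qed.

Lemma tensor_scale1 : left_id 1 tensor_scale.
Proof.
move=> x; rewrite -[x]reprK -pi_tensor_scale; congr \pi.
elim/malg_indU: (repr x) => [|f g e1 e2|a [v w]].
- by rewrite /tfree_scale malg_push0.
- by rewrite /tfree_scale malg_pushD -!/(tfree_scale _ _) e1 e2.
- by rewrite /tfree_scale malg_pushU /= scale1r.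
Qed.

Lemma tensor_scaleDr : right_distributive tensor_scale +%R.
Proof.
move=> s x y; rewrite -[x]reprK -[y]reprK -pi_tensorD -!pi_tensor_scale.
by rewrite /tfree_scale malg_pushD pi_tensorD.
Qed.

Lemma tensor_scaleDl x : {morph tensor_scale^~ x : s t / s + t}.
Proof.
move=> s t; rewrite -[x]reprK -!pi_tensor_scale -pi_tensorD.
apply/eqP; rewrite -Quotient.idealrBE; apply/asboolP.
elim/malg_indU: (repr x) => [|f g e1 e2|a [v w]].
- by rewrite /tfree_scale !malg_push0 addr0 subr0; exact: TensorRel0.
- rewrite /tfree_scale !malg_pushD -!/(tfree_scale _ _).
  have -> (p q r1 r2 u1 u2 : tfree) :
    p + q - (r1 + r2 + (u1 + u2)) = (p - (r1 + u1)) - (0 - (q - (r2 + u2))).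
    by rewrite sub0r opprK [RHS]addrACA -opprD [in LHS](addrACA r1).
  exact: (TensorRelB e1 (TensorRelB TensorRel0 e2)).
- rewrite /tfree_scale !malg_pushU /= scalerDl.
  have Ua u : << a *g (u, w) >> = tgen u w *~ a :> tfree.
    by rewrite /tgen -raddfMz /= intz.
  rewrite !Ua.
  have := TensorRelDl (s *: v) (t *: v) w.
  move: (tgen _ _) (tgen _ _) (tgen _ _) => x1 x2 x3 h.
  rewrite opprD addrA -!mulrzBl.
  apply/asboolP; have /asboolP hs := h.
  exact: (@rpredMz _ tensor_sub a _ hs).
Qed.

HB.instance Definition _ := GRing.Zmodule_isLmodule.Build S tensor_type
  tensor_scaleA tensor_scale1 tensor_scaleDr tensor_scaleDl.

Definition tens (v : V) (w : W) : tensor_type := \pi_tensor_type (tgen v w).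

End Module.

(* The biadditive product with (v, w) (v', w') = (v v', w w').  When X and Y
   satisfy the algebra axioms it descends to the tensor product. *)
Definition tfree_mul (X : alg S) (Y : alg R) :
    {malg int[(X * Y)%type]} -> {malg int[(X * Y)%type]} ->
    {malg int[(X * Y)%type]} :=
  conv (fun x y => (amul x.1 y.1, amul x.2 y.2)).

Definition tensor (X : alg S) (Y : alg R) : alg S :=
  @Alg S (tensor_type X Y) (lift_op2 (tensor_type X Y) (@tfree_mul X Y)).

End Tensor.

Section Basis.
Variables (R : nzRingType) (V : lmodType R) (I : choiceType).

Definition lincomb (e : I -> V) (c : {malg R[I]}) : V :=
  \sum_(i <- msupp c) c@_i *: e i.

Lemma lincombE (e : I -> V) (d : {fset I}) c :
  (msupp c `<=` d)%fset -> lincomb e c = \sum_(i <- d) c@_i *: e i.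
Proof.
move=> le_d; rewrite /lincomb (big_fset_incl _ le_d) //= => i _.
by move/mcoeff_outdom => ->; rewrite scale0r.
Qed.

Lemma lincombB (e : I -> V) : {morph lincomb e : c d / c - d}.
Proof.
move=> c d; rewrite (lincombE _ (msuppB_le c d)).
rewrite (lincombE _ (fsubsetUl _ (msupp d))).
rewrite (lincombE _ (fsubsetUr (msupp c) _)) -sumrB.
by apply/eq_bigr => i _; rewrite mcoeffB scalerBl.
Qed.

(* The family bvec is a basis: taking coordinates is inverse to taking finite
   linear combinations.  In particular bvec is injective. *)
Record basis := Basis {
  bvec :> I -> V;
  bcoord : V -> {malg R[I]};
  bcoordK : cancel bcoord (lincomb bvec);
  lincombK : cancel (lincomb bvec) bcoord }.

Definition coef (e : basis) (i : I) (v : V) : R := mcoeff i (bcoord e v).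

(* v belongs to the span of the e i with P i, with coefficients in S *)
Definition in_span (S : R -> Prop) (P : I -> Prop) (e : I -> V) (v : V) : Prop :=
  exists c : {malg R[I]},
    [/\ forall i, S c@_i, forall i, c@_i != 0 -> P i & v = lincomb e c].

End Basis.

Definition finite_rank (R : nzRingType) (V : lmodType R) : Prop :=
  exists n : nat, inhabited (basis V 'I_n).

(* Normalized table algebras over Z; B indexes the elements of the basis. *)
Record table_algebra (G : pzRingType) (B : choiceType) := TableAlgebra {
  tbasis :> basis (zmodule G) B;
  tone : B;
  tbar : G -> G;
  tbarB : B -> B;
  tone_eq : tbasis tone = 1 :> G;
  tcoef_ge0 : forall b b' b'' : B,
    0 <= coef tbasis b'' ((tbasis b : G) * (tbasis b' : G));
  tbarD : {morph tbar : x y / x + y};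
  tbarM : forall x y, tbar (x * y) = tbar y * tbar x;
  tbarK : involutive tbar;
  tbar_basis : forall b, tbar (tbasis b) = tbasis (tbarB b);
  tcoef_bar : forall b b' b'' : B,
    coef tbasis b'' ((tbasis b : G) * (tbasis b' : G)) =
    coef tbasis b ((tbasis b'' : G) * tbar (tbasis b')) }.

(* The index type of Im(C), the disjoint union of the M l * B l * M l *)
Definition cell_index (L : choiceType) (M : L -> finType) (B : L -> choiceType)
    : choiceType :=
  {l : L & (M l * B l * M l)%type}.

Section Tabular.
Variables (disp : Order.disp_t) (L : finPOrderType disp) (A : alg laurent).

Record table_datum := TableDatum {
  tdG : L -> pzRingType;
  tdB : L -> choiceType;
  tdT : forall l, table_algebra (tdG l) (tdB l);
  tdM : L -> finType;
  tdC : basis A (cell_index tdM tdB);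
  tdstar : A -> A }.

Variable D : table_datum.

Local Notation G := (tdG D).
Local Notation B := (tdB D).
Local Notation T := (tdT D).
Local Notation M := (tdM D).
Local Notation X := (cell_index M B).
Local Notation star := (tdstar D).

Definition cidx l (S : M l) (b : B l) (U : M l) : X :=
  Tagged (fun l => (M l * B l * M l)%type) (S, b, U).

Local Notation C := (tdC D : X -> A).

(* C_{S,U}^g for g in Gamma(l) *)
Definition Cg l (S U : M l) (g : G l) : A :=
  \sum_(b <- msupp (bcoord (T l) g)) (coef (T l) b g)%:~R *: C (cidx S b U).

(* C_{S,U}^{r g} for g in Gamma(l) and r in A (x) Gamma(l), the latter being
   given by its coordinates with respect to B(l) *)
Definition Crg l (S U : M l) (r : {malg laurent[B l]}) (g : G l) : A :=
  \sum_(b <- msupp r) r@_b *: Cg S U ((T l b : G l) * g).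

Definition A_lt (l : L) : A -> Prop :=
  in_span (fun _ => True) (fun x : X => (tag x < l)%O) C.

(* E is the set of the mutually orthogonal idempotents 1_e in Im(C); the third
   clause says that A is the sum of the 1_e A 1_e'. *)
Definition tabular_idempotents : Prop :=
  exists E : X -> Prop,
    [/\ forall e, E e -> amul (C e) (C e) = C e,
        forall e e', E e -> E e' -> e <> e' -> amul (C e) (C e') = 0,
        forall a : A, exists s : seq (X * A * X),
          (forall t, t \in s -> E t.1.1 /\ E t.2) /\
          a = \sum_(t <- s) amul (amul (C t.1.1) t.1.2) (C t.2)
      & forall x : X, exists e e', [/\ E e, E e' &
          C x = amul (amul (C e) (C x)) (C e')]].

Definition tabular_star : Prop :=
  [/\ forall (c : laurent) (x y : A), star (c *: x + y) = c *: star x + star y,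
      involutive star,
      forall x y : A, star (amul x y) = amul (star y) (star x)
    & forall l (S U : M l) (b : B l),
        star (C (cidx S b U)) = C (cidx U (tbarB (T l) b) S)].

Definition tabular_left : Prop :=
  forall (l : L) (a : A) (S : M l), exists r : M l -> {malg laurent[B l]},
  forall (U : M l) (g : G l),
    A_lt l (amul a (Cg S U g) - \sum_(S' : M l) Crg S' U (r S') g).

Definition tabular : Prop :=
  [/\ assoc_alg_axioms A, tabular_idempotents, tabular_star & tabular_left].

(* g_{x,y,z} *)
Definition struct_const (x y z : X) : laurent := coef (tdC D) z (amul (C x) (C y)).

Definition is_a_function (a : X -> int) : Prop :=
  forall z,
    (exists x y, has_degree (struct_const x y z) (a z)) /\
    (forall x y m, has_degree (struct_const x y z) m -> m <= a z).

Variable a : X -> int.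

Definition gamma (x y z : X) : int := lcoef (struct_const x y z) (a z).

Definition tabular_degrees : Prop :=
  (forall x y z : X,
     has_degree (struct_const x y z) (a z) <->
     exists l (S U V : M l) (b b' b'' : B l),
       [/\ x = cidx S b U, y = cidx U b' V, z = cidx S b'' V &
           coef (T l) b'' ((T l b : G l) * (T l b' : G l)) != 0]) /\
  (forall l (S U V : M l),
     gamma (cidx S (tone (T l)) U) (cidx U (tone (T l)) V)
           (cidx S (tone (T l)) V) = 1).

(* p = q modulo v^-1 Z[v^-1] *)
Definition laurent_eqmod (p q : laurent) : Prop :=
  exists2 u, laurent_minus u & p - q = vpow (-1) * u.

Definition tabular_trace_map : Prop :=
  exists tau : A -> laurent,
    [/\ forall (c : laurent) (x y : A), tau (c *: x + y) = c * tau x + tau y,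
        forall x : A, tau x = tau (star x),
        forall x y : A, tau (amul x y) = tau (amul y x)
      & forall l (S U : M l) (b : B l), let x := cidx S b U in
          laurent_eqmod (tau (vpow (a x) *: C x))
                        (((S == U) && (b == tone (T l)))%:R)].

Definition with_trace : Prop :=
  tabular_degrees /\ tabular_trace_map.

Section Asymptotic.
Variable l : L.

(* The product of A_l sends x, y in the span of c_l to the c_l-component of the
   product of x and y in A. *)
Definition cell_proj (x : A) : A :=
  \sum_(i <- msupp (bcoord (tdC D) x) | tag i == l) coef (tdC D) i x *: C i.

Definition chat (x : X) : A := vpow (- a x) *: C x.

(* A_l^-, generated over Z[v^-1] by the v^(-a(X)) X for X in c_l *)
Definition cell_minus : {pred A} := fun x =>
  `[< in_span laurent_minus (fun i : X => tag i = l) chat x >].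

Lemma cell_minus_zmod : zmod_closed cell_minus.
Proof.
split=> [|x y /asboolP[c [Sc Pc ->]] /asboolP[d [Sd Pd ->]]]; apply/asboolP.
  exists 0; split=> [i m _|i|]; rewrite ?mcoeff0 ?eqxx ?/lcoef ?mcoeff0 //.
  by rewrite /lincomb msupp0 big_seq_fset0.
exists (c - d); split=> [i m m0|i|]; last by rewrite lincombB.
  by rewrite mcoeffB /lcoef mcoeffB [mcoeff m _]Sc ?[mcoeff m _]Sd ?subr0.
rewrite mcoeffB; have [->|/Pc//] := eqVneq c@_i 0.
by rewrite sub0r oppr_eq0 => /Pd.
Qed.

HB.instance Definition _ := GRing.isZmodClosed.Build A cell_minus
  cell_minus_zmod.

Record cell_minus_type := CellMinus {
  cell_val :> A; cell_valP : cell_val \in cell_minus }.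

HB.instance Definition _ := [isSub for cell_val].
HB.instance Definition _ := [Choice of cell_minus_type by <:].
HB.instance Definition _ := [SubChoice_isSubZmodule of cell_minus_type by <:].

(* The default value of insubd is never used for a tabular algebra with trace,
   A_l^- being then closed under the product of A_l. *)
Definition cell_minus_mul (x y : cell_minus_type) : cell_minus_type :=
  insubd 0 (cell_proj (amul (x : A) (y : A))).

(* v^-1 A_l^- *)
Definition cell_vminus : {pred cell_minus_type} := fun x =>
  `[< exists y : cell_minus_type, (x : A) = vpow (-1) *: (y : A) >].

Lemma cell_vminus_zmod : zmod_closed cell_vminus.
Proof.
split=> [|x y /asboolP[x' ex] /asboolP[y' ey]]; apply/asboolP.
  by exists 0; rewrite scaler0.
by exists (x' - y'); rewrite scalerBr -ex -ey.
Qed.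

HB.instance Definition _ := GRing.isZmodClosed.Build cell_minus_type cell_vminus
  cell_vminus_zmod.

Definition cell_quot : zmodType := {ideal_quot cell_vminus}.

(* A_l^- / v^-1 A_l^- with the product induced by that of A_l *)
Definition asym_cell : alg int :=
  @Alg int (zmodule cell_quot)
    (lift_op2 {ideal_quot cell_vminus} cell_minus_mul).

End Asymptotic.

Definition asym : alg int := dsum asym_cell.

End Tabular.

Notation td_index D := (cell_index (tdM D) (tdB D)).

(* Main.v *)
(** By (A3), left multiplication on a cell commutes with right multiplication by
    Gamma(l) modulo lower cells, so with the anti-automorphism * every structure
    constant inside a cell is determined by those of products
    C_{V,U}^1 C_{U,V}^1.  Comparing degrees there, (A4) forces
    the leading term to sit at b = 1; hence the a-function is constant on each
    cell and gamma is the table of matrix units tensored with Gamma(l), which is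
    (i).  For (ii), Lusztig's homomorphism from A to Z[v,v^-1] (x) A^oo sends x
    to the cell components of the products x C_{U,U}^1.  After rescaling by
    powers of v its matrix in the given bases becomes the identity at v = oo, so
    its determinant is nonzero and the homomorphism is invertible over Q(v). *)

From HB Require Import structures.
Require Import Defs.
From mathcomp Require Import all_boot all_order all_algebra.
From mathcomp Require Import generic_quotient ring_quotient boolp.
From mathcomp Require Import finmap monalg.

Set Implicit Arguments.
Unset Strict Implicit.
Unset Printing Implicit Defensive.

Import Order.TTheory GRing.Theory Num.Theory.
Local Open Scope ring_scope.
Local Open Scope quotient_scope.

(** The degree argument may not presuppose that a is constant on a cell, so it runs inside one
    column. For fixed U and V, the coefficients of C_{S,U}^b C_{U,V}^1 at the C_{S,V}^c are integer
    combinations of the coefficients p of C_{V,U}^1 C_{U,V}^1 at the C_{V,V}^e, so their degrees are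
    at most m, the largest degree occurring in p. By (A4) a(C_{V,V}^c) is the degree of such a
    coefficient, whence a(C_{V,V}^c) <= m, with equality where p reaches m; there (A4), read in the
    other direction, gives c = 1. Columns are compared only afterwards.

    Lusztig's map is multiplicative because left multiplication only descends in the order of cells:
    a term of x (y C_{U,U}^1) that ends in the cell of U has never left it.

    Tensor products are quotients, so independence in them is certified by linear functionals dual
    to a spanning family. For the tensors 1 (x) C_X over Q(v) spanning suffices, since the nonzero
    determinant yields independence as well. *)

(** * Linear maps, bilinear products and isomorphisms *)

Lemma linear_exists (R : nzRingType) (V W : lmodType R) (f : V -> W) :
  linear f -> exists g : {linear V -> W}, g =1 f.
Proof.
move=> lin_f; pose F := GRing.isLinear.Build R V W *:%R f lin_f.
pose g : {linear V -> W} := HB.pack f F.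
by exists g.
Qed.

(** What is needed to compute products on generators; it is propagated below through tensor
    products, direct sums and isomorphisms. *)
Definition bilinear_amul (R : nzRingType) (X : alg R) : Prop :=
  [/\ left_distributive (@amul R X) +%R, right_distributive (@amul R X) +%R,
      forall (c : R) (x y : X), amul (c *: x) y = c *: amul x y
    & forall (c : R) (x y : X), amul x (c *: y) = c *: amul x y].

Section BilinearProduct.
Variables (R : nzRingType) (X : alg R).
Hypothesis bX : bilinear_amul X.

Lemma amulDl (x y z : X) : amul (x + y) z = amul x z + amul y z.
Proof. by case: bX => H _ _ _; rewrite H. Qed.

Lemma amulDr (x y z : X) : amul z (x + y) = amul z x + amul z y.
Proof. by case: bX => _ H _ _; rewrite H. Qed.

Lemma amulZl c (x y : X) : amul (c *: x) y = c *: amul x y.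
Proof. by case: bX. Qed.

Lemma amulZr c (x y : X) : amul x (c *: y) = c *: amul x y.
Proof. by case: bX. Qed.

Lemma amul0l (x : X) : amul 0 x = 0.
Proof. by apply: (addrI (amul 0 x)); rewrite -amulDl !addr0. Qed.

Lemma amul0r (x : X) : amul x 0 = 0.
Proof. by apply: (addrI (amul x 0)); rewrite -amulDr !addr0. Qed.

Lemma amul_suml I (r : seq I) (P : pred I) (F : I -> X) y :
  amul (\sum_(i <- r | P i) F i) y = \sum_(i <- r | P i) amul (F i) y.
Proof.
exact: (big_morph (fun x => amul x y) (fun _ _ => amulDl _ _ _) (amul0l y)).
Qed.

Lemma amul_sumr I (r : seq I) (P : pred I) (F : I -> X) y :
  amul y (\sum_(i <- r | P i) F i) = \sum_(i <- r | P i) amul y (F i).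
Proof.
exact: (big_morph (amul y) (fun _ _ => amulDr _ _ _) (amul0r y)).
Qed.

End BilinearProduct.

Lemma assoc_bilinear (R : nzRingType) (X : alg R) :
  assoc_alg_axioms X -> bilinear_amul X.
Proof. by case. Qed.

Lemma alg_iso_sym (R : nzRingType) (X Y : alg R) : alg_iso X Y -> alg_iso Y X.
Proof.
case=> f [[g fK gK] fM].
have lin_g : linear g by move=> c x y; apply: (can_inj fK); rewrite linearP !gK.
have [h hE] := linear_exists lin_g; exists h; split.
  by exists f => x; rewrite hE ?gK ?fK.
by move=> x y; rewrite !hE; apply: (can_inj fK); rewrite fM !gK.
Qed.

Lemma alg_iso_trans (R : nzRingType) (X Y Z : alg R) :
  alg_iso X Y -> alg_iso Y Z -> alg_iso X Z.
Proof.
case=> f [bf fM] [g [bg gM]]; have lin_gf : linear (g \o f).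
  by move=> c x y /=; rewrite !linearP.
have [h hE] := linear_exists lin_gf; exists h; split.
  by apply: (@eq_bij _ _ (g \o f)); [exact: bij_comp | move=> x; rewrite hE].
by move=> x y; rewrite !hE /= fM gM.
Qed.

Lemma alg_iso_bilinear (R : nzRingType) (X Y : alg R) :
  alg_iso X Y -> bilinear_amul Y -> bilinear_amul X.
Proof.
case=> f [/bij_inj f_inj fM] bY; split=> [x y z|x y z|c x y|c x y];
  apply: f_inj; rewrite !(fM, linearD, linearZ) /= ?fM.
- exact: amulDl.
- exact: amulDr.
- exact: amulZl.
- exact: amulZr.
Qed.

Lemma lincomb0 (R : nzRingType) (V : lmodType R) (I : choiceType) (e : I -> V) :
  lincomb e 0 = 0.
Proof. by rewrite /lincomb msupp0 big_seq_fset0. Qed.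

Lemma lincombU (R : nzRingType) (V : lmodType R) (I : choiceType) (e : I -> V) c i :
  lincomb e << c *g i >> = c *: e i.
Proof. by rewrite (lincombE _ msuppU_le) big_seq_fset1 mcoeffUU. Qed.

Lemma lincombD (R : nzRingType) (V : lmodType R) (I : choiceType) (e : I -> V) :
  {morph lincomb e : c d / c + d}.
Proof.
move=> c d; apply: (addIr (- lincomb e d)).
by rewrite -lincombB addrK -addrA subrr addr0.
Qed.

Lemma lincombZ (R : nzRingType) (V : lmodType R) (I : choiceType) (e : I -> V) r c :
  lincomb e (r *: c) = r *: lincomb e c.
Proof.
rewrite (lincombE _ (msuppZ_le r c)) /lincomb scaler_sumr.
by apply: eq_bigr => i _; rewrite mcoeffZ scalerA.
Qed.

(** * Tensor products of algebras *)

Section TensorModule.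
Variables (R : nzRingType) (S : comNzRingType) (phi : R -> S).
Variables (V : lmodType S) (W : lmodType R).
Local Notation VW := (tensor_type phi V W).

Lemma tensZl s (v : V) (w : W) : s *: tens phi v w = tens phi (s *: v) w.
Proof.
rewrite /tens -tfree_scale_gen; apply: esym.
exact: (pi_tensor_scale phi s (tgen v w)).
Qed.

Lemma tens_relE (x y : {malg int[(V * W)%type]}) :
  tensor_rel phi (x - y) -> \pi_VW x = \pi_VW y.
Proof. by move=> h; apply/eqP; rewrite -Quotient.idealrBE; apply/asboolP. Qed.

Lemma tensDl (v v' : V) (w : W) : tens phi (v + v') w = tens phi v w + tens phi v' w.
Proof.
rewrite /tens -pi_tensorD; apply: tens_relE.
by rewrite opprD addrA; exact: TensorRelDl.
Qed.

Lemma tensDr (v : V) (w w' : W) : tens phi v (w + w') = tens phi v w + tens phi v w'.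
Proof.
rewrite /tens -pi_tensorD; apply: tens_relE.
by rewrite opprD addrA; exact: TensorRelDr.
Qed.

Lemma tensZr r (v : V) (w : W) : tens phi v (r *: w) = tens phi (phi r *: v) w.
Proof. by apply: esym; apply: tens_relE; exact: TensorRelZ. Qed.

Lemma tens0l (w : W) : tens phi (0 : V) w = 0.
Proof. by apply: (addrI (tens phi 0 w)); rewrite -tensDl !addr0. Qed.

Lemma tens0r (v : V) : tens phi v (0 : W) = 0.
Proof. by apply: (addrI (tens phi v 0)); rewrite -tensDr !addr0. Qed.

Lemma tens_suml I (r : seq I) (P : pred I) (F : I -> V) (w : W) :
  tens phi (\sum_(i <- r | P i) F i) w = \sum_(i <- r | P i) tens phi (F i) w.
Proof.
exact: (big_morph (fun x => tens phi x w) (fun _ _ => tensDl _ _ _) (tens0l w)).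
Qed.

Lemma tens_sumr I (r : seq I) (P : pred I) (F : I -> W) (v : V) :
  tens phi v (\sum_(i <- r | P i) F i) = \sum_(i <- r | P i) tens phi v (F i).
Proof.
exact: (big_morph (tens phi v) (fun _ _ => tensDr _ _ _) (tens0r v)).
Qed.

Lemma pi_malgU a (v : V) (w : W) : \pi_VW << a *g (v, w) >> = tens phi v w *~ a.
Proof. by rewrite /tens /tgen -(raddfMz \pi_VW) -(raddfMz (@mkmalgU _ _ _)) intz. Qed.

Lemma tensor_ind (P : VW -> Prop) :
  P 0 -> (forall x y, P x -> P y -> P (x + y)) -> (forall v w, P (tens phi v w)) ->
  forall x, P x.
Proof.
move=> P0 PD PT x; rewrite -[x]reprK.
elim/malg_indU: (repr x) => [|f g Pf Pg|a [v w]].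
- by rewrite (raddf0 \pi_VW).
- by rewrite pi_tensorD; exact: PD.
by rewrite pi_malgU -scaler_int tensZl.
Qed.

(** Universal property: the additive extension of b to the free group kills the relators, so
    evaluation on representatives is well defined. All linear maps out of tensor products are
    obtained from it. *)
Lemma tensor_lift (Z : lmodType S) (b : V -> W -> Z) :
  (forall v v' w, b (v + v') w = b v w + b v' w) ->
  (forall v w w', b v (w + w') = b v w + b v w') ->
  (forall s v w, b (s *: v) w = s *: b v w) ->
  (forall r v w, b v (r *: w) = phi r *: b v w) ->
  exists f : {linear VW -> Z}, forall v w, f (tens phi v w) = b v w.
Proof.
move=> bDl bDr bZl bZr.
(* Z becomes a module over the integers, the coefficients of the free group being integers. *)
pose e (i : (V * W)%type) : zmodule Z := b i.1 i.2.
pose f (x : VW) : Z := lincomb e (repr x).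
have rel0 x : tensor_rel phi x -> lincomb e x = 0.
  elim=> [|y z _ hy _ hz|v v' w|v w w'|r v w]; first exact: lincomb0.
  - by rewrite lincombB hy hz subrr.
  - rewrite !lincombB !lincombU !scale1r /e /= bDl.
    by rewrite -addrA -opprD subrr.
  - rewrite !lincombB !lincombU !scale1r /e /= bDr.
    by rewrite -addrA -opprD subrr.
  - by rewrite !lincombB !lincombU !scale1r /e /= bZl bZr subrr.
have fpi x : f (\pi_VW x) = lincomb e x.
  apply: (@subr0_eq (zmodule Z)); rewrite /f -lincombB; apply: rel0.
  apply/asboolP; have : repr (\pi_VW x) - x \in tensor_sub phi (V := V) (W := W).
    by rewrite Quotient.idealrBE reprK.
  by [].
have fT v w : f (tens phi v w) = b v w by rewrite fpi lincombU scale1r.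
have fD x y : f (x + y) = f x + f y.
  by rewrite -[x]reprK -[y]reprK -pi_tensorD !fpi lincombD.
have f0 : f 0 = 0 by apply: (addrI (f 0)); rewrite -fD !addr0.
have fZ s x : f (s *: x) = s *: f x.
  elim/tensor_ind: x => [|x y hx hy|v w]; first by rewrite scaler0 f0 scaler0.
    by rewrite scalerDr !fD hx hy scalerDr.
  by rewrite tensZl !fT bZl.
have [g gE] : exists g : {linear VW -> Z}, g =1 f.
  by apply: linear_exists => s x y; rewrite fD fZ.
by exists g => v w; rewrite gE fT.
Qed.

End TensorModule.

Lemma tensor_map (R : nzRingType) (S : comNzRingType) (phi : R -> S)
    (V : lmodType S) (W W' : lmodType R) (f : {linear W -> W'}) :
  exists g : {linear tensor_type phi V W -> tensor_type phi V W'},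
    forall v w, g (tens phi v w) = tens phi v (f w).
Proof.
apply: (@tensor_lift _ _ phi V W (tensor_type phi V W')
  (fun v w => tens phi v (f w))).
- by move=> *; rewrite tensDl.
- by move=> *; rewrite linearD tensDr.
- by move=> *; rewrite tensZl.
- by move=> *; rewrite linearZ tensZr tensZl.
Qed.

Section TensorAlgebra.
Variables (R : nzRingType) (S : comNzRingType) (phi : R -> S).
Variables (X : alg S) (Y : alg R).
Hypotheses (bX : bilinear_amul X) (bY : bilinear_amul Y).
Local Notation XY := (tensor_type phi X Y).
Local Notation tmul := (@tfree_mul R S X Y).

(** One half of the fact that the relators span a two-sided ideal of the free group: by additivity y
    may be taken to be a point mass, and then each type of relator is checked. *)
Lemma tfree_mul_pi0l x y : tensor_rel phi x -> \pi_XY (tmul x y) = 0.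
Proof.
have conv_gen v w v' w' c : tmul (tgen v w) << c *g (v', w') >> =
    << c *g (amul v v', amul w w') >>.
  by rewrite /tfree_mul /tgen convUU mul1r.
have mulB a b c : tmul (a - b) c = tmul a c - tmul b c.
  apply: (addIr (tmul b c)); rewrite /tfree_mul -convDl !subrK //.
elim/malg_indU: y => [|y z hy hz|c [v' w']] hx.
- by rewrite /tfree_mul conv0r (raddf0 \pi_XY).
- by rewrite /tfree_mul convDr pi_tensorD -!/(tmul _ _) hy // hz // addr0.
elim: hx => [|y z _ hy _ hz|v v2 w|v w w2|r v w].
- by rewrite /tfree_mul conv0l (raddf0 \pi_XY).
- by rewrite mulB (raddfB \pi_XY) /= hy hz subrr.
- rewrite !mulB !conv_gen !(raddfB \pi_XY) /= !pi_malgU.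
  by rewrite (amulDl bX) tensDl mulrzDl -addrA -opprD subrr.
- rewrite !mulB !conv_gen !(raddfB \pi_XY) /= !pi_malgU.
  by rewrite (amulDl bY) tensDr mulrzDl -addrA -opprD subrr.
- rewrite !mulB !conv_gen !(raddfB \pi_XY) /= !pi_malgU.
  by rewrite (amulZl bX) (amulZl bY) tensZr subrr.
Qed.

Lemma tfree_mul_pi0r x y : tensor_rel phi y -> \pi_XY (tmul x y) = 0.
Proof.
have conv_gen v w v' w' c : tmul << c *g (v', w') >> (tgen v w) =
    << c *g (amul v' v, amul w' w) >>.
  by rewrite /tfree_mul /tgen convUU mulr1.
have mulB a b c : tmul c (a - b) = tmul c a - tmul c b.
  apply: (addIr (tmul c b)); rewrite /tfree_mul -convDr !subrK //.
elim/malg_indU: x => [|x z hy hz|c [v' w']] hx.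
- by rewrite /tfree_mul conv0l (raddf0 \pi_XY).
- by rewrite /tfree_mul convDl pi_tensorD -!/(tmul _ _) hy // hz // addr0.
elim: hx => [|y' z _ hy _ hz|v v2 w|v w w2|r v w].
- by rewrite /tfree_mul conv0r (raddf0 \pi_XY).
- by rewrite mulB (raddfB \pi_XY) /= hy hz subrr.
- rewrite !mulB !conv_gen !(raddfB \pi_XY) /= !pi_malgU.
  by rewrite (amulDr bX) tensDl mulrzDl -addrA -opprD subrr.
- rewrite !mulB !conv_gen !(raddfB \pi_XY) /= !pi_malgU.
  by rewrite (amulDr bY) tensDr mulrzDl -addrA -opprD subrr.
- rewrite !mulB !conv_gen !(raddfB \pi_XY) /= !pi_malgU.
  by rewrite (amulZr bX) (amulZr bY) tensZr subrr.
Qed.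

(** The lifted product multiplies chosen representatives; these differ from x and y by relators,
    which contribute zero. *)
Lemma pi_tfree_mul x y :
  @amul S (tensor phi X Y) (\pi_XY x) (\pi_XY y) = \pi_XY (tmul x y).
Proof.
rewrite /amul /= -lock.
have repr_rel z : tensor_rel phi (repr (\pi_XY z) - z).
  apply/asboolP; have : repr (\pi_XY z) - z \in tensor_sub phi (V := X) (W := Y).
    by rewrite Quotient.idealrBE reprK.
  by [].
set x' := repr _; set y' := repr _.
have -> : x' = x + (x' - x) by rewrite addrC subrK.
have -> : y' = y + (y' - y) by rewrite addrC subrK.
rewrite /tfree_mul convDl convDr !pi_tensorD -!/(tmul _ _).
by rewrite (tfree_mul_pi0l _ (repr_rel x)) (tfree_mul_pi0r _ (repr_rel y)) !addr0.
Qed.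

Lemma amul_tens (x x' : X) (y y' : Y) :
  @amul S (tensor phi X Y) (tens phi x y) (tens phi x' y') =
  tens phi (amul x x') (amul y y').
Proof. by rewrite /tens pi_tfree_mul /tfree_mul /tgen convUU mulr1. Qed.

Lemma tensor_bilinear : bilinear_amul (tensor phi X Y).
Proof.
have mulDl : left_distributive (@amul S (tensor phi X Y)) +%R.
  move=> x y z; rewrite -[x]reprK -[y]reprK -[z]reprK.
  by rewrite -pi_tensorD !pi_tfree_mul /tfree_mul convDl pi_tensorD.
have mulDr : right_distributive (@amul S (tensor phi X Y)) +%R.
  move=> x y z; rewrite -[x]reprK -[y]reprK -[z]reprK.
  by rewrite -pi_tensorD !pi_tfree_mul /tfree_mul convDr pi_tensorD.
have mul0l x : @amul S (tensor phi X Y) 0 x = 0.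
  by apply: (addrI (amul 0 x)); rewrite -mulDl !addr0.
have mul0r x : @amul S (tensor phi X Y) x 0 = 0.
  by apply: (addrI (amul x 0)); rewrite -mulDr !addr0.
split=> // c.
- elim/tensor_ind => [y|x x' hx hx' y|v w y].
  + by rewrite scaler0 !mul0l scaler0.
  + by rewrite scalerDr !mulDl hx hx' scalerDr.
  + elim/tensor_ind: y => [|y y' hy hy'|v' w'].
    * by rewrite !mul0r scaler0.
    * by rewrite !mulDr hy hy' scalerDr.
    * by rewrite tensZl !amul_tens (amulZl bX) tensZl.
- move=> x; elim/tensor_ind => [|y y' hy hy'|v w].
  + by rewrite scaler0 !mul0r scaler0.
  + by rewrite scalerDr !mulDr hy hy' scalerDr.
  + elim/tensor_ind: x => [|y y' hy hy'|v' w'].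
    * by rewrite !mul0l scaler0.
    * by rewrite !mulDl hy hy' scalerDr.
    * by rewrite tensZl !amul_tens (amulZr bX) tensZl.
Qed.

End TensorAlgebra.

Lemma tensor_morph (R : nzRingType) (S : comNzRingType) (phi : R -> S)
    (X : alg S) (Y : alg R) (Z : alg S) (f : {linear tensor phi X Y -> Z}) :
  bilinear_amul X -> bilinear_amul Y -> bilinear_amul Z ->
  (forall x x' y y', f (tens phi (amul x x') (amul y y')) =
     amul (f (tens phi x y)) (f (tens phi x' y'))) ->
  {morph f : x y / amul x y}.
Proof.
move=> bX bY bZ fM x y; have bXY := tensor_bilinear phi bX bY.
elim/tensor_ind: x => [|x x' hx hx'|v w].
- by rewrite (amul0l bXY) !linear0 (amul0l bZ).
- by rewrite (amulDl bXY) !linearD /= hx hx' (amulDl bZ).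
elim/tensor_ind: y => [|y y' hy hy'|v' w'].
- by rewrite (amul0r bXY) !linear0 (amul0r bZ).
- by rewrite (amulDr bXY) !linearD /= hy hy' (amulDr bZ).
- by rewrite amul_tens.
Qed.

Lemma tensor_iso (R : nzRingType) (S : comNzRingType) (phi : R -> S)
    (X : alg S) (Y Y' : alg R) : bilinear_amul X -> bilinear_amul Y' ->
  alg_iso Y Y' -> alg_iso (tensor phi X Y) (tensor phi X Y').
Proof.
move=> bX bY' isoY; have bY := alg_iso_bilinear isoY bY'.
have [g [bg _]] := alg_iso_sym isoY.
case: isoY => f [[f' fK f'K] fM].
have lin_f' : linear f'.
  by move=> c x y; apply: (can_inj fK); rewrite linearP !f'K.
have [h hE] := linear_exists lin_f'.
have [F FE] := tensor_map phi X f; have [H HE] := tensor_map phi X h.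
exists F; split.
  exists H; elim/tensor_ind => [|x y hx hy|v w].
  - by rewrite !linear0.
  - by rewrite !linearD /= hx hy.
  - by rewrite FE HE hE fK.
  - by rewrite !linear0.
  - by rewrite !linearD /= hx hy.
  - by rewrite HE FE hE f'K.
apply: tensor_morph => // [|x x' y y']; first exact: tensor_bilinear.
by rewrite !FE amul_tens // fM.
Qed.

(** * Direct sums *)

Section DirectSum.
Variables (R : nzRingType) (L : finType).

Section Module.
Variable V : L -> lmodType R.

Definition dsum_inj l (x : V l) : dsum_type V :=
  [ffun i => dfwith (fun i => 0 : V i) x i].

Definition dsum_coord l (f : dsum_type V) : V l := f l.

Lemma dsum_ext (f g : dsum_type V) :
  (forall l, dsum_coord l f = dsum_coord l g) -> f = g.
Proof. by move=> h; apply/ffunP => l; exact: h. Qed.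

Lemma dsum_coord_linear l : linear (@dsum_coord l).
Proof. by move=> c f g; rewrite /dsum_coord !ffunE. Qed.

HB.instance Definition _ l :=
  GRing.isLinear.Build R (dsum_type V) (V l) *:%R (@dsum_coord l)
    (dsum_coord_linear l).

Lemma dsum_coord_inj l (x : V l) : dsum_coord l (dsum_inj x) = x.
Proof. by rewrite /dsum_coord ffunE dfwith_in. Qed.

Lemma dsum_coord_inj_neq l l' (x : V l) : l != l' -> dsum_coord l' (dsum_inj x) = 0.
Proof. by move=> ne; rewrite /dsum_coord ffunE dfwith_out. Qed.

Lemma dsum_inj_linear l : linear (@dsum_inj l).
Proof.
move=> c x y; apply: dsum_ext => l'; rewrite linearP /=.
have [<-|ne] := eqVneq l l'; first by rewrite !dsum_coord_inj.
by rewrite !dsum_coord_inj_neq // scaler0 addr0.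
Qed.

HB.instance Definition _ l :=
  GRing.isLinear.Build R (V l) (dsum_type V) *:%R (@dsum_inj l)
    (@dsum_inj_linear l).

Lemma dsum_sum_inj (f : dsum_type V) : f = \sum_l dsum_inj (dsum_coord l f).
Proof.
apply: dsum_ext => l; rewrite linear_sum (bigD1 l) //= dsum_coord_inj.
by rewrite big1 ?addr0 // => i ne; rewrite dsum_coord_inj_neq.
Qed.

End Module.

Lemma dsum_coordM (X : L -> alg R) l (f g : dsum X) :
  dsum_coord l (amul f g) = amul (dsum_coord l f) (dsum_coord l g).
Proof. by rewrite /dsum_coord ffunE. Qed.

Lemma dsum_bilinear (X : L -> alg R) :
  (forall l, bilinear_amul (X l)) -> bilinear_amul (dsum X).
Proof.
move=> bX; split=> [f g h|f g h|c f g|c f g]; apply: dsum_ext => l.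
- by rewrite linearD /= !dsum_coordM linearD /= (amulDl (bX l)).
- by rewrite linearD /= !dsum_coordM linearD /= (amulDr (bX l)).
- by rewrite linearZ /= !dsum_coordM linearZ /= (amulZl (bX l)).
- by rewrite linearZ /= !dsum_coordM linearZ /= (amulZr (bX l)).
Qed.

Lemma dsum_iso (X Y : L -> alg R) :
  (forall l, alg_iso (X l) (Y l)) -> alg_iso (dsum X) (dsum Y).
Proof.
move=> isoXY.
have P l : exists fg : {linear X l -> Y l} * (Y l -> X l),
    [/\ cancel fg.1 fg.2, cancel fg.2 fg.1 & {morph fg.1 : x y / amul x y}].
  by have [f [[g fK gK] fM]] := isoXY l; exists (f, g).
pose fg l := projT1 (cid (P l)); have fgP l := projT2 (cid (P l)).
pose F (x : dsum X) : dsum Y := [ffun l => (fg l).1 (dsum_coord l x)].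
pose G (y : dsum Y) : dsum X := [ffun l => (fg l).2 (dsum_coord l y)].
have FE l x : dsum_coord l (F x) = (fg l).1 (dsum_coord l x).
  by rewrite {1}/dsum_coord ffunE.
have GE l y : dsum_coord l (G y) = (fg l).2 (dsum_coord l y).
  by rewrite {1}/dsum_coord ffunE.
have linF : linear F.
  by move=> c x y; apply: dsum_ext => l; rewrite linearP /= !FE !linearP.
have [H HE] := linear_exists linF; exists H; split.
  exists G => x; apply: dsum_ext => l; rewrite ?HE ?FE ?GE ?HE ?FE.
    by case: (fgP l) => ->.
  by case: (fgP l) => _ ->.
move=> x y; rewrite !HE; apply: dsum_ext => l.
by rewrite dsum_coordM !FE dsum_coordM; case: (fgP l).
Qed.

End DirectSum.

(** The inverse is the sum over l of the maps induced by the inclusions of the summands. *)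
Lemma tensor_dsum_iso (R : nzRingType) (S : comNzRingType) (phi : R -> S)
    (L : finType) (X : alg S) (Y : L -> alg R) :
  bilinear_amul X -> (forall l, bilinear_amul (Y l)) ->
  alg_iso (tensor phi X (dsum Y)) (dsum (fun l => tensor phi X (Y l))).
Proof.
move=> bX bY; pose Z := dsum (fun l => tensor phi X (Y l)).
have bXY l := tensor_bilinear phi bX (bY l).
pose b (x : X) (y : dsum Y) : Z :=
  [ffun l => tens phi x (dsum_coord l y) : tensor phi X (Y l)].
have bE l x y : dsum_coord l (b x y) = tens phi x (dsum_coord l y).
  by rewrite {1}/dsum_coord ffunE.
have [f fE] : exists f : {linear tensor phi X (dsum Y) -> Z},
    forall x y, f (tens phi x y) = b x y.
  apply: tensor_lift => *; apply: dsum_ext => l.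
  - by rewrite linearD /= !bE tensDl.
  - by rewrite linearD /= !bE linearD /= tensDr.
  - by rewrite linearZ /= !bE tensZl.
  - by rewrite linearZ /= !bE linearZ /= tensZr tensZl.
have P l := tensor_map phi X (@dsum_inj R L Y l).
pose g l := projT1 (cid (P l)).
have gE l : forall v w, g l (tens phi v w) = tens phi v (dsum_inj w).
  exact: (projT2 (cid (P l))).
exists f; split.
  exists (fun z : Z => \sum_l g l (dsum_coord l z)).
    elim/tensor_ind => [|x y hx hy|v w].
    - by rewrite linear0 big1 // => l _; rewrite !linear0.
    - rewrite -[in RHS]hx -[in RHS]hy -big_split; apply: eq_bigr => l _ /=.
      by rewrite !linearD.
    - rewrite [w in RHS]dsum_sum_inj tens_sumr; apply: eq_bigr => l _.
      by rewrite fE bE gE.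
  move=> z; rewrite linear_sum [z in RHS]dsum_sum_inj; apply: eq_bigr => l _ /=.
  move: (dsum_coord l z); elim/tensor_ind => [|x y hx hy|v w].
  - by rewrite !linear0.
  - by rewrite !linearD /= hx hy.
  - rewrite gE fE; apply: dsum_ext => l'; rewrite bE.
    have [<-|ne] := eqVneq l l'; first by rewrite !dsum_coord_inj.
    by rewrite !dsum_coord_inj_neq // tens0r.
apply: tensor_morph => //; [exact: dsum_bilinear|exact: dsum_bilinear|].
move=> x x' y y'; apply: dsum_ext => l.
by rewrite dsum_coordM !fE !bE dsum_coordM amul_tens.
Qed.

(** * Laurent polynomials *)

(** An upper bound that the zero polynomial also satisfies, hence stable under sums, unlike
    [has_degree]. *)
Definition deg_le (p : laurent) (n : int) : Prop :=
  forall m, n < m -> lcoef p m = 0.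

Lemma lcoefD m (p q : laurent) : lcoef (p + q) m = lcoef p m + lcoef q m.
Proof. exact: mcoeffD. Qed.

Lemma lcoef0 m : lcoef 0 m = 0.
Proof. exact: mcoeff0. Qed.

Lemma lcoef_sum I (r : seq I) (P : pred I) (F : I -> laurent) m :
  lcoef (\sum_(i <- r | P i) F i) m = \sum_(i <- r | P i) lcoef (F i) m.
Proof.
exact: (big_morph (fun p => lcoef p m) (fun _ _ => lcoefD m _ _) (lcoef0 m)).
Qed.

Lemma lcoefMz (p : laurent) n m : lcoef (p *~ n) m = lcoef p m *~ n.
Proof. exact: (raddfMz (@mcoeff _ _ m)). Qed.

Lemma lcoefMw (d1 d2 : {fset int}) (p q : laurent) k :
  (msupp p `<=` d1)%fset -> (msupp q `<=` d2)%fset ->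
  lcoef (p * q) k =
  \sum_(i <- d1) \sum_(j <- d2) (lcoef p i * lcoef q j) *+ (i + j == k).
Proof.
move=> le1 le2; rewrite /lcoef [p * q](convE _ le1 le2) raddf_sum /=.
apply: eq_bigr => i _; rewrite raddf_sum /=; apply: eq_bigr => j _.
by rewrite mcoeffU.
Qed.

Section Degree.
Variables (p q : laurent) (m n : int).
Hypotheses (dp : deg_le p m) (dq : deg_le q n).

Lemma deg_leM : deg_le (p * q) (m + n).
Proof.
move=> k lt_k; rewrite (lcoefMw _ (fsubset_refl _) (fsubset_refl _)).
rewrite big1 // => i _; rewrite big1 // => j _.
case: eqP => [eq_k|//]; rewrite mulr1n.
have [lt_m|le_m] := ltP m i; first by rewrite dp ?mul0r.
have [lt_n|le_n] := ltP n j; first by rewrite dq ?mulr0.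
by move: lt_k; rewrite -eq_k ltNge lerD.
Qed.

Lemma lcoefM_top : lcoef (p * q) (m + n) = lcoef p m * lcoef q n.
Proof.
(* Adjoining m and n to the supports lets the term (m, n) be split off even when it is zero. *)
rewrite (lcoefMw _ (fsubsetUr [fset m]%fset _) (fsubsetUr [fset n]%fset _)).
rewrite (bigD1_seq m) /= ?fset_uniq ?in_fsetU ?in_fset1 ?eqxx //.
rewrite (bigD1_seq n) /= ?fset_uniq ?in_fsetU ?in_fset1 ?eqxx //.
rewrite mulr1n big1 ?big1 ?addr0 // => [i ne_i|j ne_j].
  rewrite big1 // => j _; case: eqP => [eq_k|//]; rewrite mulr1n.
  have [lt_m|le_m] := ltP m i; first by rewrite dp ?mul0r.
  have [lt_n|le_n] := ltP n j; first by rewrite dq ?mulr0.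
  have lt_i : i < m by rewrite lt_neqAle ne_i.
  by have := ltr_leD lt_i le_n; rewrite eq_k ltxx.
by case: eqP => // /addrI eq_j; rewrite eq_j eqxx in ne_j.
Qed.

End Degree.

Lemma lcoef_vpow n m : lcoef (vpow n) m = (n == m)%:R.
Proof. by rewrite /lcoef mcoeffU. Qed.

Lemma lcoef_vpowM n (p : laurent) m : lcoef (vpow n * p) m = lcoef p (m - n).
Proof.
rewrite (lcoefMw _ msuppU_le (fsubsetUr [fset m - n]%fset _)) big_seq_fset1.
rewrite (bigD1_seq (m - n)) /= ?fset_uniq ?in_fsetU ?in_fset1 ?eqxx //.
rewrite lcoef_vpow eqxx mul1r subrKC eqxx mulr1n big1 ?addr0 // => j ne_j.
by case: eqP => // eq_m; rewrite -eq_m addrC addKr eqxx in ne_j.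
Qed.

Lemma vpowD m n : vpow (m + n) = vpow m * vpow n.
Proof. by apply: esym; rewrite [LHS]convUU mulr1. Qed.

Lemma vpow0 : vpow 0 = 1. Proof. by []. Qed.

Lemma vpowNK n : vpow (- n) * vpow n = 1.
Proof. by rewrite -vpowD addNr. Qed.

Lemma lcoef_intrM (p : laurent) (c m : int) : lcoef (p * c%:~R) m = lcoef p m * c.
Proof. by rewrite mulrzr lcoefMz -mulrzr intz. Qed.

Lemma laurent_Qv_w (d : {fset int}) (p : laurent) : (msupp p `<=` d)%fset ->
  laurent_Qv p = \sum_(m <- d) (lcoef p m)%:~R * Qv_v ^ m.
Proof.
move=> le_d; rewrite /laurent_Qv (big_fset_incl _ le_d) //= => m _.
by move/mcoeff_outdom => h; rewrite /lcoef h mul0r.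
Qed.

Lemma laurent_Qv_is_additive : zmod_morphism laurent_Qv.
Proof.
move=> p q; rewrite (laurent_Qv_w (msuppB_le p q)).
rewrite (laurent_Qv_w (fsubsetUl _ (msupp q))).
rewrite (laurent_Qv_w (fsubsetUr (msupp p) _)) -sumrB.
by apply: eq_bigr => m _; rewrite /lcoef mcoeffB intrB mulrBl.
Qed.

HB.instance Definition _ :=
  GRing.isZmodMorphism.Build laurent Qv laurent_Qv laurent_Qv_is_additive.

Lemma laurent_QvU (c n : int) :
  laurent_Qv (<< c *g n >> : laurent) = c%:~R * Qv_v ^ n.
Proof. by rewrite (laurent_Qv_w msuppU_le) big_seq_fset1 /lcoef mcoeffUU. Qed.

Lemma Qv_v_neq0 : Qv_v != 0.
Proof. by rewrite tofrac_eq0 polyX_eq0. Qed.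

Lemma laurent_Qv_is_monoid : monoid_morphism laurent_Qv.
Proof.
split; first by rewrite laurent_QvU mulr1.
move=> p q.
elim/malg_indU: p => [|p1 p2 e1 e2|c i]; first by rewrite mul0r raddf0 mul0r.
  by rewrite mulrDl !raddfD /= e1 e2 mulrDl.
elim/malg_indU: q => [|p1 p2 e1 e2|d j]; first by rewrite mulr0 raddf0 mulr0.
  by rewrite mulrDr !raddfD /= e1 e2 mulrDr.
have -> : (<< c *g i >> : laurent) * << d *g j >> = << c * d *g i + j >>.
  exact: convUU.
by rewrite !laurent_QvU (expfzDr _ _ Qv_v_neq0) intrM mulrACA.
Qed.

HB.instance Definition _ :=
  GRing.isMonoidMorphism.Build laurent Qv laurent_Qv laurent_Qv_is_monoid.

(** Clearing denominators by v^(size p) turns p(v^-1) into a polynomial q in v, namely v times the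
    reversal of p, whose coefficient at degree [size p] is the constant term of p. *)
Lemma poly_Qv_vinv_neq0 (p : {poly int}) :
  p`_0 != 0 -> (map_poly intr p).[Qv_v^-1] != 0.
Proof.
move=> p0; pose q : {poly rat} := \sum_(i < size p) (p`_i)%:~R *: 'X^(size p - i).
have eq_q : (map_poly intr p).[Qv_v^-1] * Qv_v ^+ size p = tofrac q.
  rewrite (horner_coef_wide _ (size_poly _ _)) mulr_suml /q rmorph_sum /=.
  apply: eq_bigr => i _; rewrite coef_map /= -mul_polyC rmorphM /= rmorphXn /=.
  rewrite !rmorph_int -mulrA exprVn; congr (_ * _).
  by rewrite expfB ?ltn_ord // mulrC.
have sp : (0 < size p)%N.
  by rewrite lt0n size_poly_eq0; apply: contraNneq p0 => ->; rewrite coef0.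
have q_top : q`_(size p) = (p`_0)%:~R.
  rewrite coef_sum (bigD1 (Ordinal sp)) //= subn0 coefZ coefXn eqxx mulr1.
  rewrite big1 ?addr0 // => i ne_i; rewrite coefZ coefXn.
  have -> : (size p == size p - i)%N = false; last by rewrite mulr0.
  have i_gt0 : (0 < i)%N by rewrite lt0n; apply: contraNneq ne_i => i0; apply/eqP/val_inj.
  by apply/negbTE; rewrite neq_ltn ltn_subrL i_gt0 sp orbT.
apply: contraNneq p0 => ev0; rewrite ev0 mul0r in eq_q.
have /eqP : tofrac q = 0 by [].
rewrite tofrac_eq0 => /eqP q0; move: q_top; rewrite q0 coef0.
by move/esym/eqP; rewrite intr_eq0.
Qed.

(** Writing p as v^n r(v^-1) makes the value of v^(-n) p at v = oo the constant term of r. *)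
Lemma laurent_Qv_poly (p : laurent) n : deg_le p n ->
  exists2 r : {poly int}, r`_0 = lcoef p n &
    laurent_Qv p = (map_poly intr r).[Qv_v^-1] * Qv_v ^ n.
Proof.
move=> dp; exists (\sum_(m <- msupp p) (lcoef p m) *: 'X^`|n - m|).
  rewrite coef_sum.
  under eq_bigr => m _ do rewrite coefZ coefXn eq_sym absz_eq0 subr_eq0 mulr_natr.
  rewrite /lcoef; case: msuppP => h.
    rewrite (bigD1_seq n) ?fset_uniq //= eqxx mulr1n big1 ?addr0 // => m.
    by rewrite eq_sym => /negbTE ->.
  rewrite big1_seq // => m /= hm; case: eqP => // eq_m.
  by move: h; rewrite eq_m hm.
rewrite rmorph_sum /= horner_sum mulr_suml; apply: eq_big_seq => m hm.
rewrite map_polyZ map_polyXn hornerZ hornerXn exprVn -mulrA; congr (_ * _).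
have le_m : m <= n.
  by rewrite leNgt; apply: contraL hm => /dp; rewrite -mcoeff_eq0 => /eqP.
have -> : Qv_v ^+ `|n - m| = Qv_v ^ (n - m).
  by rewrite exprnP gez0_abs // subr_ge0.
by rewrite invr_expz -(expfzDr _ _ Qv_v_neq0) opprB subrK.
Qed.

(* After scaling column z by v^(- n z), the matrix is the identity at v = oo. *)
Lemma det_laurent_Qv_neq0 N (H : 'M[laurent]_N) (n : 'I_N -> int) :
  (forall i j, deg_le (H i j) (n j)) ->
  (forall i j, lcoef (H i j) (n j) = (i == j)%:R) ->
  \det (map_mx laurent_Qv H) != 0.
Proof.
move=> dH topH.
have P i j : exists r : {poly int}, r`_0 = (i == j)%:R /\
    laurent_Qv (H i j) = (map_poly intr r).[Qv_v^-1] * Qv_v ^ n j.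
  by have [r r0 rE] := laurent_Qv_poly (dH i j); exists r; rewrite -topH.
pose r i j := projT1 (cid (P i j)); have rP i j := projT2 (cid (P i j)).
pose Pm : 'M[{poly int}]_N := \matrix_(i, j) r i j.
pose ev : {poly int} -> Qv := horner_eval (Qv_v^-1) \o map_poly intr.
have -> : map_mx laurent_Qv H =
    map_mx ev Pm *m diag_mx (\row_j Qv_v ^ n j).
  by apply/matrixP => i j; rewrite mul_mx_diag !mxE (rP i j).2.
rewrite det_mulmx det_diag mulf_neq0 //.
  rewrite det_map_mx; apply: poly_Qv_vinv_neq0.
  (* Evaluation at 0 commutes with the determinant too, so the constant term of [\det Pm] is the
     determinant of the identity. *)
  rewrite -horner_coef0 -/(horner_eval 0 _) -det_map_mx.
  rewrite (_ : map_mx _ _ = 1%:M) ?det1 ?oner_neq0 //.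
  by apply/matrixP => i j; rewrite !mxE /= /horner_eval horner_coef0 (rP i j).1.
by apply/prodf_neq0 => j _; rewrite mxE expfz_neq0 // Qv_v_neq0.
Qed.

(** * Bases and dual families *)

Section SeqSums.
Variables (K : eqType) (s : seq K).
Hypotheses (s_uniq : uniq s) (s_full : forall x, x \in s).

Lemma sum_seq_delta (R : nzRingType) (V : lmodType R) (F : K -> V) x :
  \sum_(y <- s) (x == y)%:R *: F y = F x.
Proof.
rewrite (bigD1_seq x) //= eqxx scale1r big1 ?addr0 // => y.
by rewrite eq_sym => /negbTE ->; rewrite scale0r.
Qed.

Lemma sum_seq_reindex (V : nmodType) (J : eqType) (d : seq J) (f : J -> K)
    (F : K -> V) : injective f -> uniq d ->
  (forall x, F x != 0 -> exists2 j, j \in d & x = f j) ->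
  \sum_(x <- s) F x = \sum_(j <- d) F (f j).
Proof.
move=> f_inj d_uniq supp; rewrite -[RHS](big_map f xpredT F).
rewrite (bigID (mem (map f d))) /= [X in _ + X]big1 => [|x]; last first.
  by apply: contraNeq => /supp[j dj ->]; exact: map_f.
rewrite addr0 -big_filter; apply: perm_big; apply: uniq_perm.
- exact: filter_uniq.
- by rewrite map_inj_uniq.
- by move=> x; rewrite mem_filter s_full andbT.
Qed.

(** Finite rank will make the index set of Im(C) finite; through embeddings this passes to each cell
    and to each B(l) with M(l) nonempty. *)
Lemma full_seq_inj (J : choiceType) (f : J -> K) : injective f ->
  exists2 d : seq J, uniq d & forall j, j \in d.
Proof.
move=> f_inj; pose g x : option J :=
  if pselect (exists j, f j = x) is left h then Some (projT1 (cid h)) else None.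
exists (undup (pmap g s)) => [|j]; first exact: undup_uniq.
rewrite mem_undup mem_pmap; apply/mapP; exists (f j); rewrite ?s_full // /g.
case: pselect => [h|[]]; last by exists j.
by congr Some; apply: f_inj; rewrite (projT2 (cid h)).
Qed.

End SeqSums.

Lemma seq_max_exists (s : seq int) m : m \in s ->
  exists2 n, n \in s & forall k, k \in s -> k <= n.
Proof.
elim: s m => [//|x s IH] m _; case: s IH => [_|y s IH].
  by exists x; rewrite ?mem_seq1 // => k; rewrite inE => /eqP ->.
have [n sn n_max] := IH y (mem_head _ _).
have [le_nx|lt_xn] := leP n x.
  exists x; first exact: mem_head.
  by move=> k; rewrite inE => /orP[/eqP -> //|/n_max /le_trans]; apply.
exists n; first by rewrite inE sn orbT.
by move=> k; rewrite inE => /orP[/eqP ->|/n_max //]; exact: ltW.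
Qed.

Lemma has_degree_le p m n : deg_le p n -> has_degree p m -> m <= n.
Proof.
by move=> dp [top _]; rewrite leNgt; apply: contraNN top => /dp ->.
Qed.

Lemma has_degree_uniq p m n : has_degree p m -> has_degree p n -> m = n.
Proof.
move=> hm hn; apply/le_anti.
by rewrite (has_degree_le hm.2 hn) (has_degree_le hn.2 hm).
Qed.

Lemma has_degree_exists p m : lcoef p m != 0 ->
  exists2 n, m <= n & has_degree p n.
Proof.
rewrite /lcoef mcoeff_neq0 => pm; have [n pn n_max] := seq_max_exists pm.
exists n; first exact: n_max.
split=> [|k lt_k]; first by rewrite /lcoef mcoeff_neq0.
by apply: contraTeq lt_k; rewrite /lcoef mcoeff_neq0 -leNgt => /n_max.
Qed.

Section BasisCoordinates.
Variables (R : nzRingType) (V : lmodType R) (I : choiceType) (e : basis V I).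

Lemma basis_coefD i x y : coef e i (x + y) = coef e i x + coef e i y.
Proof.
rewrite /coef -{1}(bcoordK e x) -{1}(bcoordK e y).
by rewrite -lincombD lincombK mcoeffD.
Qed.

Lemma basis_coefZ i c x : coef e i (c *: x) = c * coef e i x.
Proof. by rewrite /coef -{1}(bcoordK e x) -lincombZ lincombK mcoeffZ. Qed.

Lemma basis_coef0 i : coef e i 0 = 0.
Proof. by rewrite -(scale0r 0) basis_coefZ mul0r. Qed.

Lemma basis_coefB i x y : coef e i (x - y) = coef e i x - coef e i y.
Proof. by rewrite basis_coefD -scaleN1r basis_coefZ mulN1r. Qed.

Lemma basis_coef_sum i J (r : seq J) (P : pred J) (F : J -> V) :
  coef e i (\sum_(j <- r | P j) F j) = \sum_(j <- r | P j) coef e i (F j).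
Proof.
exact: (big_morph (coef e i) (fun _ _ => basis_coefD i _ _) (basis_coef0 i)).
Qed.

Lemma coef_lincomb i c : coef e i (lincomb e c) = c@_i.
Proof. by rewrite /coef lincombK. Qed.

Lemma coef_basis i j : coef e i (e j) = (i == j)%:R.
Proof.
by rewrite -[e j]scale1r -lincombU coef_lincomb mcoeffU eq_sym.
Qed.

Lemma bcoord_basis i : bcoord e (e i) = << 1 *g i >>.
Proof. by rewrite -[e i]scale1r -lincombU lincombK. Qed.

Lemma basis_inj : injective e.
Proof.
move=> i j eq_e; have := coef_basis i j; rewrite -eq_e coef_basis eqxx.
by case: eqP => // _ /eqP; rewrite oner_eq0.
Qed.

Lemma coef_sum_basis (s : seq I) v : uniq s -> (forall i, i \in s) ->
  v = \sum_(i <- s) coef e i v *: e i.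
Proof.
move=> s_uniq s_full; rewrite -{1}[v](bcoordK e).
have [d dE] : exists d : {fset I}, d =i s.
  by exists [fset x in s]%fset => x; rewrite inE.
rewrite (lincombE _ (d := d)); last by apply/fsubsetP => x _; rewrite dE.
by apply: perm_big; apply: uniq_perm => //; rewrite fset_uniq.
Qed.

End BasisCoordinates.

(** The finitely many vectors of a finite basis f involve finitely many indices of e. An index i
    outside them would have coefficient 0 in every combination of f, in particular in e i itself. *)
Lemma finite_rank_index (R : nzRingType) (V : lmodType R) (I : choiceType)
    (e : basis V I) : finite_rank V ->
  exists2 s : seq I, uniq s & forall i, i \in s.
Proof.
case=> n [f]; pose s := flatten [seq enum_fset (msupp (bcoord e (f j))) | j : 'I_n].
exists (undup s) => [|i]; first exact: undup_uniq.
rewrite mem_undup; apply: contraT => s'i; have := coef_basis e i i.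
rewrite -{1}[e i](bcoordK f) /lincomb basis_coef_sum eqxx big1 => [/esym/eqP|j _].
  by rewrite oner_eq0.
rewrite basis_coefZ [X in _ * X](_ : _ = 0) ?mulr0 //.
apply/eqP; apply: contraNT s'i; rewrite mcoeff_neq0 => hi.
by apply/flatten_mapP; exists j; rewrite ?mem_enum.
Qed.

Lemma inj_surj_bij (V W : Type) (f : V -> W) :
  injective f -> (forall w, exists v, f v = w) -> bijective f.
Proof.
move=> f_inj f_surj; pose g w := projT1 (cid (f_surj w)).
have gK : cancel g f by move=> w; exact: (projT2 (cid (f_surj w))).
by exists g => // v; apply: f_inj; rewrite gK.
Qed.

Lemma additive_int_linear (V W : lmodType int) (f : V -> W) :
  {morph f : x y / x + y} -> linear f.
Proof.
move=> fD c x y; have [g gE] : exists g : {additive V -> W}, g =1 f.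
  have f_zmod : zmod_morphism f.
    by move=> u v; apply: (addIr (f v)); rewrite -fD !subrK.
  pose F := GRing.isZmodMorphism.Build V W f f_zmod.
  by pose g : {additive V -> W} := HB.pack f F; exists g.
by rewrite -[c]intz !scaler_int -!gE raddfD raddfMz.
Qed.

(** A basis presented by its coordinate functionals: biorthogonality gives independence, the
    expansion gives spanning. This form suits quotients, where functionals come from universal
    properties. *)
Definition dual_family (R : nzRingType) (V : lmodType R) (K : choiceType)
    (s : seq K) (y : K -> V) (p : K -> {linear V -> R^o}) : Prop :=
  (forall i j, p i (y j) = (i == j)%:R) /\
  (forall v, v = \sum_(i <- s) p i v *: y i).

(** Generation is stated as an induction principle so that induction on tensors and on finite sums
    can establish it. *)
Lemma dual_family_gen (R : nzRingType) (V : lmodType R) (K : choiceType)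
    (s : seq K) (y : K -> V) (p : K -> {linear V -> R^o}) :
  uniq s -> (forall i, i \in s) -> (forall i j, p i (y j) = (i == j)%:R) ->
  (forall P : V -> Prop, P 0 -> (forall u v, P u -> P v -> P (u + v)) ->
     (forall c u, P u -> P (c *: u)) -> (forall i, P (y i)) -> forall v, P v) ->
  dual_family s y p.
Proof.
move=> s_uniq s_full py gen; split=> // v; elim/gen: v => [|u v hu hv|c u hu|j].
- by rewrite big1 // => i _; rewrite linear0 scale0r.
- rewrite [in LHS]hu [in LHS]hv -big_split; apply: eq_bigr => i _ /=.
  by rewrite linearD scalerDl.
- rewrite [in LHS]hu scaler_sumr; apply: eq_bigr => i _.
  by rewrite linearZ_LR /= -[in RHS]scalerA.
- rewrite -[LHS](sum_seq_delta s_uniq s_full y); apply: eq_bigr => i _.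
  by rewrite py eq_sym.
Qed.

Lemma dual_family_ext (R : nzRingType) (V : lmodType R) (K : choiceType)
    (s : seq K) (y : K -> V) (p : K -> {linear V -> R^o}) u v :
  dual_family s y p -> (forall i, p i u = p i v) -> u = v.
Proof.
move=> [_ yE] eq_p; rewrite (yE u) (yE v).
by apply: eq_bigr => i _; rewrite eq_p.
Qed.

Lemma basis_ext (R : nzRingType) (V : lmodType R) (I : choiceType) (e : basis V I)
  u v : (forall i, coef e i u = coef e i v) -> u = v.
Proof.
move=> h; rewrite -(bcoordK e u) -(bcoordK e v); congr lincomb.
by apply/malgP => i; exact: h.
Qed.

Section DirectSumDual.

Variables (L : finType) (Y : L -> alg int) (K : L -> choiceType).
Variables (y : forall l, K l -> Y l).
Variables (p : forall l, K l -> {linear Y l -> int^o}).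
Local Notation X := {l : L & K l}.
Variables (s : seq X) (d : forall l, seq (K l)).
Hypotheses (s_uniq : uniq s) (s_full : forall x, x \in s).
Hypothesis (dual_yp : forall l, dual_family (d l) (@y l) (@p l)).

Definition dsum_family (x : X) : dsum Y := dsum_inj (y (tagged x)).

Lemma dsum_dual : exists2 q : X -> {linear dsum Y -> int^o},
  dual_family s dsum_family q &
  forall x v, q x v = p (tagged x) (dsum_coord (tag x) v).
Proof.
have q_ex (x : X) : exists q : {linear dsum Y -> int^o},
    q =1 (fun v => p (tagged x) (dsum_coord (tag x) v)).
  by apply: linear_exists => c u v; rewrite !linearP.
pose q x := projT1 (cid (q_ex x)).
have qE x v : q x v = p (tagged x) (dsum_coord (tag x) v).
  exact: (projT2 (cid (q_ex x))).
exists q => //; apply: dual_family_gen => // [[l i] [l' j]|P P0 PD PZ Py v].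
  rewrite qE /dsum_family /=; have [el|ne] := eqVneq l l'; last first.
    rewrite dsum_coord_inj_neq 1?eq_sym // linear0.
    by case: eqP => // /(congr1 tag)/= el; rewrite el eqxx in ne.
  by subst l'; rewrite dsum_coord_inj (dual_yp l).1 eq_Tagged.
rewrite (dsum_sum_inj v); apply: big_ind => // l _.
rewrite ((dual_yp l).2 (dsum_coord l v)) linear_sum; apply: big_ind => // i _.
by rewrite linearZ; apply: PZ; exact: (Py (Tagged K i)).
Qed.

End DirectSumDual.

(** * Coefficient algebras, extension of scalars and invertibility *)

Lemma regular_bilinear (k : fieldType) : bilinear_amul (regular_alg k).
Proof.
split=> [x y z|x y z|c x y|c x y]; rewrite /amul /=.
- exact: mulrDl.
- exact: mulrDr.
- exact: (esym (mulrA c (x : k) y)).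
- exact: (mulrCA (x : k) c y).
Qed.

Lemma matrix_bilinear n : bilinear_amul (matrix_alg n).
Proof.
split=> [x y z|x y z|c x y|c x y]; rewrite /amul /=.
- exact: mulmxDl.
- exact: mulmxDr.
- by rewrite scalemxAl.
- by rewrite scalemxAr.
Qed.

Lemma int_alg_bilinear (G : pzRingType) : bilinear_amul (int_alg G).
Proof.
have scE (c : int) (x : zmodule G) : c *: x = (x : G) *~ c.
  by rewrite -[c in LHS]intz scaler_int.
split=> [x y z|x y z|c x y|c x y]; rewrite /amul /= ?scE.
- exact: (@mulrDl G).
- exact: (@mulrDr G).
- exact: (@mulrzAl G).
- exact: (@mulrzAr G).
Qed.

Section ScalarExtension.
Variables (k : fieldType) (Y : alg int) (K : choiceType) (s : seq K).
Variables (y : K -> Y) (p : K -> {linear Y -> int^o}).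
Hypotheses (s_uniq : uniq s) (s_full : forall x, x \in s).
Hypothesis (dual_yp : dual_family s y p).
Local Notation kY := (tensor (intr : int -> k) (regular_alg k) Y).

Definition ext_family (x : K) : kY := tens intr (1 : regular_alg k) (y x).

Lemma ext_dual : exists2 q : K -> {linear kY -> k^o},
  dual_family s ext_family q &
  forall x c v, q x (tens intr (c : regular_alg k) v) = c * (p x v)%:~R.
Proof.
have q_ex (x : K) : exists q : {linear kY -> k^o}, forall (c : regular_alg k) v,
    q (tens intr c v) = (c : k) * (p x v)%:~R.
  apply: (@tensor_lift _ _ intr (regular_alg k) Y k^o
    (fun c v => (c : k) * (p x v)%:~R)) => [c c' v|c v v'|t c v|r c v].
  - by rewrite mulrDl.
  - by rewrite linearD intrD mulrDr.
  - exact: (esym (mulrA t (c : k) _)).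
  - have -> : p x (r *: v) = r * p x v by rewrite linearZ_LR.
    by rewrite intrM; exact: mulrCA.
pose q x := projT1 (cid (q_ex x)).
have qE x c v : q x (tens intr c v) = c * (p x v)%:~R.
  exact: (projT2 (cid (q_ex x))).
exists q => //; apply: dual_family_gen => // [i j|P P0 PD PZ Py v].
  by rewrite qE mul1r dual_yp.1 rmorph_nat.
elim/tensor_ind: v => // c v; rewrite [v](dual_yp.2) tens_sumr.
apply: big_ind => // i _; rewrite tensZr.
rewrite [X in tens intr X](_ : _ = (((p i v)%:~R * c) : k) *: (1 : regular_alg k)).
  by rewrite -tensZl; apply: PZ; exact: Py.
by apply: esym; exact: mulr1.
Qed.

End ScalarExtension.

(** Let H be the matrix of coordinates of the f (e x) in y. If f kills a combination of e, its
    coefficient row is killed by H, so it vanishes; and any w is reached by solving with the inverse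
    of H. Thus spanning by e is enough, and its independence comes along. *)
Lemma linear_bij (k : fieldType) (V W : lmodType k) (K : eqType) (s : seq K)
    (e : K -> V) (y : K -> W) (q : K -> W -> k) (f : {linear V -> W}) :
  (forall x, linear (q x : W -> k^o)) -> uniq s ->
  (forall v, exists c : K -> k, v = \sum_(x <- s) c x *: e x) ->
  (forall w, w = \sum_(x <- s) q x w *: y x) ->
  \det (\matrix_(i < size s, j < size s)
    q (tnth (in_tuple s) j) (f (e (tnth (in_tuple s) i)))) != 0 ->
  bijective f.
Proof.
move=> q_lin s_uniq e_gen y_gen; set H := \matrix_(i, j) _ => detH.
have qD x u v : q x (u + v) = q x u + q x v.
  by have := q_lin x 1 u v; rewrite !scale1r.
have q0 x : q x 0 = 0 by apply: (addrI (q x 0)); rewrite -qD !addr0.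
have qZ x c v : q x (c *: v) = c * q x v.
  by have := q_lin x c v 0; rewrite q0 !addr0.
have qf (c : K -> k) j : q (tnth (in_tuple s) j) (f (\sum_(x <- s) c x *: e x)) =
    ((\row_i c (tnth (in_tuple s) i)) *m H) 0 j.
  rewrite linear_sum (big_morph (q _) (qD _) (q0 _)) big_tnth mxE.
  by apply: eq_bigr => i _; rewrite linearZ qZ !mxE.
have H_unit : H \in unitmx by rewrite unitmxE unitfE.
apply: inj_surj_bij => [u v eq_f|w].
  apply/eqP; rewrite -subr_eq0; have [c cE] := e_gen (u - v).
  have c0 : \row_i c (tnth (in_tuple s) i) = 0.
    rewrite -[LHS](mulmxK H_unit) [X in X *m _](_ : _ = 0) ?mul0mx //.
    apply/rowP => j; rewrite -qf -cE linearB eq_f subrr q0 mxE //.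
  rewrite cE big_tnth big1 // => i _.
  by have /rowP/(_ i) := c0; rewrite !mxE => ->; rewrite scale0r.
pose r := (\row_j q (tnth (in_tuple s) j) w) *m invmx H.
(* The row r is read at the position of x in s; the value 0 concerns only elements outside s. *)
pose c x := if insub (index x s) is Some i then r 0 i else 0.
have cE : \row_i c (tnth (in_tuple s) i) = r.
  apply/rowP => i; rewrite mxE /c (tnth_nth (tnth (in_tuple s) i)) /=.
  rewrite index_uniq //; case: insubP => [j _ ej|]; last by rewrite ltn_ord.
  by congr (r 0 _); apply: val_inj.
exists (\sum_(x <- s) c x *: e x); rewrite [LHS]y_gen [RHS]y_gen.
apply: eq_big_seq => x /seq_tnthP[j ->]; congr (_ *: _).
by rewrite qf cE mulmxKV // mxE.
Qed.

(** * Table algebras *)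

Section TableAlgebra.
Variables (G : pzRingType) (B : choiceType) (T : table_algebra G B).

Definition kappa (b'' b b' : B) : int := coef T b'' ((T b : G) * (T b' : G)).

Lemma kappa_1l b'' b : kappa b'' (tone T) b = (b'' == b)%:R.
Proof. by rewrite /kappa tone_eq mul1r coef_basis. Qed.

Lemma kappa_1r b'' b : kappa b'' b (tone T) = (b'' == b)%:R.
Proof. by rewrite /kappa tone_eq mulr1 coef_basis. Qed.

Lemma tbarBK : involutive (tbarB T).
Proof.
by move=> b; apply: (@basis_inj _ _ _ T); rewrite -!tbar_basis tbarK.
Qed.

(** bar 1 = bar 1 * bar (bar 1) = bar (bar 1 * 1) = 1. *)
Lemma tbarB1 : tbarB T (tone T) = tone T.
Proof.
apply: (@basis_inj _ _ _ T); rewrite -tbar_basis tone_eq.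
by rewrite -[LHS]mulr1 -{2}(tbarK T 1) -tbarM mulr1 tbarK.
Qed.

End TableAlgebra.

(** * Leading coefficients of the structure constants *)

Section TabularAlgebra.
Variables (disp : Order.disp_t) (L : finPOrderType disp).
Variables (A : alg laurent) (D : table_datum L A) (a : td_index D -> int).

Local Notation G := (tdG D).
Local Notation B := (tdB D).
Local Notation T := (tdT D).
Local Notation M := (tdM D).
Local Notation X := (td_index D).
Local Notation C := (tdC D).
Local Notation sc := (@struct_const _ _ _ D).

Hypotheses (tabD : tabular D) (a_fun : is_a_function a).
Hypothesis (degD : tabular_degrees a).
Variables (s : seq X).
Hypotheses (s_uniq : uniq s) (s_full : forall x, x \in s).

Lemma tabular_bilinear : bilinear_amul A.
Proof. by case: tabD => /assoc_bilinear. Qed.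

Lemma cidx_inj l (S S' : M l) (b b' : B l) (U U' : M l) :
  (cidx S b U == cidx S' b' U' :> X) = [&& S == S', b == b' & U == U'].
Proof. by rewrite /cidx eq_Tagged /= !xpair_eqE andbA. Qed.

(** B(l) embeds into the index set of Im(C) as soon as some S is at hand; for empty M(l) it may be
    infinite. *)
Lemma cell_enum l (S : M l) : exists2 d : seq (B l), uniq d & forall b, b \in d.
Proof.
apply: (full_seq_inj s_full (f := fun b => cidx S b S)) => b b' /eqP.
by rewrite cidx_inj => /and3P[_ /eqP].
Qed.

Lemma Cg_basis l (S U : M l) b : Cg S U (T l b) = C (cidx S b U).
Proof.
rewrite /Cg bcoord_basis msuppU oner_eq0 big_seq_fset1 coef_basis eqxx.
by rewrite scale1r.
Qed.

Lemma coef_Cg l (S U S' U' : M l) b (g : G l) :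
  coef C (cidx S' b U') (Cg S U g) =
  (coef (T l) b g)%:~R *+ ((S' == S) && (U' == U)).
Proof.
rewrite /Cg basis_coef_sum.
under eq_bigr => c _ do rewrite basis_coefZ coef_basis cidx_inj.
case: (S' == S) => /=; last by rewrite big1 // => c _; rewrite mulr0.
case: (U' == U) => /=; last first.
  by rewrite big1 // => c _; rewrite andbF mulr0.
rewrite mulr1n; under eq_bigr => c _ do rewrite andbT.
rewrite /coef; case: msuppP => h.
  rewrite (bigD1_seq b) ?fset_uniq //= eqxx mulr1 big1 ?addr0 // => c.
  by rewrite eq_sym => /negbTE ->; rewrite mulr0.
rewrite big1_seq // => c /= hc; case: eqP => [eq_b|]; last by rewrite mulr0.
by rewrite eq_b hc in h.
Qed.

Lemma coef_Cg_out l (S U : M l) (g : G l) (z : X) :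
  tag z != l -> coef C z (Cg S U g) = 0.
Proof.
move=> ne; rewrite /Cg basis_coef_sum big1 // => c _.
rewrite basis_coefZ coef_basis; case: eqP => [eq_z|]; last by rewrite mulr0.
by rewrite eq_z eqxx in ne.
Qed.

Lemma coef_A_lt l (z : X) (v : A) : A_lt D l v -> coef C z v != 0 -> (tag z < l)%O.
Proof. by case=> c [_ h ->]; rewrite coef_lincomb => /h. Qed.

Lemma left_coef_aux l (S : M l) (x : A) : exists r : M l -> {malg laurent[B l]},
  forall (U : M l) (b : B l),
  (forall (S' U' : M l) b', coef C (cidx S' b' U') (amul x (C (cidx S b U))) =
    (\sum_(c <- msupp (r S')) (r S')@_c * (kappa (T l) b' c b)%:~R) *+ (U' == U)) /\
  (forall z : X, tag z != l -> coef C z (amul x (C (cidx S b U))) != 0 ->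
    (tag z < l)%O).
Proof.
case: tabD => _ _ _ /(_ l x S)[r rP]; exists r => U b.
have := rP U (T l b); rewrite Cg_basis => /coef_A_lt lt_l.
set v := amul x _ in lt_l *.
(* At an index whose cell is not below l, the congruence of (A3) is an equality of coefficients. *)
have vE z : ~~ (tag z < l)%O ->
    coef C z v = \sum_(S' : M l) coef C z (Crg S' U (r S') (T l b)).
  move=> nlt; apply/eqP; rewrite -subr_eq0 -basis_coef_sum -basis_coefB.
  by apply: contraNT nlt => /lt_l.
have CrgE z S' : coef C z (Crg S' U (r S') (T l b)) =
    \sum_(c <- msupp (r S')) (r S')@_c *
       coef C z (Cg S' U ((T l c : G l) * T l b)).
  rewrite /Crg basis_coef_sum; apply: eq_bigr => c _.
  by rewrite basis_coefZ.
split=> [S' U' b'|z ne_z].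
  rewrite vE ?ltxx // (bigD1 S') //= big1 => [|S1 ne_S].
    rewrite addr0 CrgE -sumrMnl; apply: eq_bigr => c _.
    by rewrite coef_Cg eqxx /= mulrnAr.
  rewrite CrgE big1 // => c _; rewrite coef_Cg eq_sym (negbTE ne_S) mulr0 //.
apply: contraR => nlt; rewrite vE // big1 // => S' _.
by rewrite CrgE big1 // => c _; rewrite coef_Cg_out ?mulr0.
Qed.

(** Taking b = 1 in (A3) identifies the coordinate r(S')_c with the coefficient of C_{S',V}^c in x
    C_{S,V}^1, for any V. Substituting this back eliminates r: the action of x on one column of b =
    1 determines it on the whole cell. *)
Lemma left_coef l (S S' U U' V : M l) b b' x (d : seq (B l)) :
    uniq d -> (forall c, c \in d) ->
  coef C (cidx S' b' U') (amul x (C (cidx S b U))) =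
  (\sum_(c <- d) coef C (cidx S' c V) (amul x (C (cidx S (tone (T l)) V))) *
     (kappa (T l) b' c b)%:~R) *+ (U' == U).
Proof.
move=> d_uniq d_full; have [r rP] := left_coef_aux S x.
have [-> _] := rP U b; case: (U' == U); last by rewrite !mulr0n.
rewrite !mulr1n.
have rE c : coef C (cidx S' c V) (amul x (C (cidx S (tone (T l)) V))) = (r S')@_c.
  have [-> _] := rP V (tone (T l)); rewrite eqxx mulr1n.
  under eq_bigr => e _ do rewrite kappa_1r.
  case: msuppP => h.
    rewrite (bigD1_seq c) ?fset_uniq //= eqxx mulr1 big1 ?addr0 // => e.
    by rewrite eq_sym => /negbTE ->; rewrite mulr0.
  rewrite big1_seq // => e /= he; case: eqP => [eq_c|]; last by rewrite mulr0.
  by rewrite eq_c he in h.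
under [RHS]eq_bigr => c _ do rewrite rE.
apply: esym; apply: (sum_seq_reindex d_uniq d_full (@inj_id _) (fset_uniq _)).
move=> c nz; exists c => //; rewrite -mcoeff_neq0.
by apply: contraNneq nz => ->; rewrite mul0r.
Qed.

Lemma left_coef_le (z w : X) x : coef C z (amul x (C w)) != 0 -> (tag z <= tag w)%O.
Proof.
case: w => l [[S b] U] /=; have [r /(_ U b)[_ h]] := left_coef_aux S x.
have [-> //|ne_z] := eqVneq (tag z) l => /(h _ ne_z); exact: ltW.
Qed.

Definition xstar (x : X) : X :=
  let: existT l (U, b, V) := x in cidx V (tbarB (T l) b) U.

Lemma xstarK : involutive xstar.
Proof. by case=> l [[S b] U] /=; rewrite tbarBK. Qed.

Lemma star_C x : tdstar D (C x) = C (xstar x).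
Proof. by case: tabD => _ _ [_ _ _ h] _; case: x => l [[S b] U]; apply: h. Qed.

Lemma coef_star z (v : A) : coef C (xstar z) (tdstar D v) = coef C z v.
Proof.
case: tabD => _ _ [star_lin _ _ _] _.
have star0 : tdstar D 0 = 0.
  have := star_lin (- 1) 0 0; rewrite scaler0 addr0 scaleN1r => ->.
  by rewrite addNr.
have starD u w : tdstar D (u + w) = tdstar D u + tdstar D w.
  by rewrite -[u]scale1r star_lin !scale1r.
have starZ c u : tdstar D (c *: u) = c *: tdstar D u.
  by rewrite -[c *: u]addr0 star_lin star0 addr0.
rewrite {1}(coef_sum_basis C v s_uniq s_full).
rewrite (big_morph (tdstar D) starD star0) basis_coef_sum.
under eq_bigr => x _ do
  rewrite starZ star_C basis_coefZ coef_basis (inj_eq (inv_inj xstarK)) mulrC.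
exact: (sum_seq_delta s_uniq s_full (V := laurent^o) (fun x => coef C x v) z).
Qed.

(** This converts the left-handed information of (A3) into information on right multiplication. *)
Lemma struct_const_star x y z : sc x y z = sc (xstar y) (xstar x) (xstar z).
Proof.
rewrite /struct_const -coef_star; case: tabD => _ _ [_ _ starM _] _.
by rewrite starM !star_C.
Qed.

Lemma struct_const_deg x y z : deg_le (sc x y z) (a z).
Proof.
move=> m lt_m; apply/eqP; apply: contraTT lt_m => /has_degree_exists[n le_n].
by move=> /((a_fun z).2 x y) le_a; rewrite -leNgt (le_trans le_n).
Qed.

Lemma gamma_neq0 x y z : gamma a x y z != 0 ->
  exists l (S U V : M l) (b b' b'' : B l),
    [/\ x = cidx S b U, y = cidx U b' V, z = cidx S b'' V &
        kappa (T l) b'' b b' != 0].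
Proof.
by move=> nz; apply/(degD.1 x y z); split=> //; exact: struct_const_deg.
Qed.

Lemma has_degree_cell l (S U V : M l) b b' b'' : kappa (T l) b'' b b' != 0 ->
  has_degree (sc (cidx S b U) (cidx U b' V) (cidx S b'' V)) (a (cidx S b'' V)).
Proof. by move=> nz; apply/(degD.1 _ _ _); exists l, S, U, V, b, b', b''. Qed.

Lemma cidx_tag_inj l l' (S U : M l) (b : B l) (S' U' : M l') (b' : B l') :
  cidx S b U = cidx S' b' U' :> X -> l = l'.
Proof. by move/(congr1 tag). Qed.

Lemma cell_gammaP l (S1 U1 S2 U2 S U : M l) b1 b2 b :
  gamma a (cidx S1 b1 U1) (cidx S2 b2 U2) (cidx S b U) != 0 ->
  [/\ S = S1, U1 = S2, U2 = U & kappa (T l) b b1 b2 != 0].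
Proof.
move/gamma_neq0 => [l' [S' [U' [V' [c [c' [c'' [e1 e2 e3 nz]]]]]]]].
have el := cidx_tag_inj e1; subst l'.
move/eqP: e1; rewrite cidx_inj => /and3P[/eqP -> /eqP -> /eqP ->].
move/eqP: e2; rewrite cidx_inj => /and3P[/eqP -> /eqP -> /eqP ->].
by move/eqP: e3; rewrite cidx_inj => /and3P[/eqP -> /eqP -> /eqP ->].
Qed.

Lemma left_coef1 l (S S' U V : M l) c x :
  coef C (cidx S' c U) (amul x (C (cidx S (tone (T l)) U))) =
  coef C (cidx S' c V) (amul x (C (cidx S (tone (T l)) V))).
Proof.
have [d d_uniq d_full] := cell_enum S.
rewrite (left_coef S S' U U V (tone (T l)) c x d_uniq d_full) eqxx mulr1n.
rewrite -[RHS](sum_seq_delta d_uniq d_full (V := laurent^o)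
  (fun c => coef C (cidx S' c V) (amul x (C (cidx S (tone (T l)) V)))) c).
by apply: eq_bigr => e _; rewrite kappa_1r rmorph_nat mulrC.
Qed.

Section Cell.
Variable l : L.
Local Notation one := (tone (T l)).
Local Notation bar := (tbarB (T l)).

Section Column.
Variables (d : seq (B l)) (U V : M l).
Hypotheses (d_uniq : uniq d) (d_full : forall b, b \in d).

(* Modulo lower cells C_{S,U}^b C_{U,V}^b' is C_{S,V}^{b q b'} for an element q
   depending only on U; p c is the coefficient of c in q. *)
Let p (c : B l) : laurent := sc (cidx V one U) (cidx U one V) (cidx V c V).

Let pE W c : p c = sc (cidx V one U) (cidx U one W) (cidx V c W).
Proof. exact: left_coef1. Qed.

(** The anti-automorphism moves C_{S,U}^b to the right-hand side, where [left_coef] describes the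
    left action of C_{V,U}^1. Any bound on the degrees of all p e therefore holds for every
    coefficient of this form. *)
Let sc_p S b c : sc (cidx S b U) (cidx U one V) (cidx S c V) =
  \sum_(e <- d) p e * (kappa (T l) (bar c) e (bar b))%:~R.
Proof.
rewrite struct_const_star /= tbarB1 {1}/struct_const.
by rewrite (left_coef U V S S V (bar b) (bar c) _ d_uniq d_full) eqxx mulr1n.
Qed.

Let p_top : exists2 m, forall c, deg_le (p c) m & exists c, lcoef (p c) m != 0.
Proof.
have k1 : kappa (T l) one one one != 0 by rewrite kappa_1l eqxx.
(* By (A4) p 1 is nonzero, so there is a degree to maximize. *)
have [p1 _] := has_degree_cell V U V k1; rewrite -/(p one) in p1.
pose t := flatten [seq enum_fset (msupp (p c)) | c <- d].
have tP c m : lcoef (p c) m != 0 -> m \in t.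
  rewrite /lcoef mcoeff_neq0 => h; apply/flatten_mapP; exists c => //.
have [m tm m_max] := seq_max_exists (tP _ _ p1).
exists m => [c k lt_k|].
  apply/eqP; apply: contraTT lt_k => /tP/m_max; by rewrite -leNgt.
have /flatten_mapP[c _ h] := tm; exists c.
by rewrite /lcoef mcoeff_neq0.
Qed.

(* An element c at which the coefficients p attain their maximal degree m has
   a(C_{V,V}^c) = m, so the bound of (A4) is attained by C^1 C^1 at c, whence
   c = 1. *)
Let p_lead W : (forall c, deg_le (p c) (a (cidx V one W))) /\
  (forall c, lcoef (p c) (a (cidx V one W)) = (c == one)%:R).
Proof.
have [m p_m [e pe]] := p_top.
have only_one c' : lcoef (p c') m != 0 -> c' = one.
  move=> pc; have hc : has_degree (p c') m by split=> //; exact: p_m.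
  have ge_m : m <= a (cidx V c' V) by exact: (a_fun _).2 hc.
  have le_m : a (cidx V c' V) <= m.
    (* By (A4) a(C_{V,V}^c') is the degree of a coefficient of C_{V,U}^c' C_{U,V}^1, which [sc_p]
       bounds by m. *)
    have k_nz : kappa (T l) c' c' one != 0 by rewrite kappa_1r eqxx.
    apply: has_degree_le (has_degree_cell V U V k_nz); rewrite sc_p => k lt_k.
    rewrite lcoef_sum big1 // => c1 _.
    by rewrite lcoef_intrM (p_m c1 _ lt_k) mul0r.
  have em : a (cidx V c' V) = m by apply/le_anti; rewrite le_m ge_m.
  have : gamma a (cidx V one U) (cidx U one V) (cidx V c' V) != 0.
    by rewrite /gamma em.
  by case/cell_gammaP => _ _ _; rewrite kappa_1l; case: (c' =P one).
have e1 := only_one _ pe; subst e.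
have k1 : kappa (T l) one one one != 0 by rewrite kappa_1l eqxx.
have h1 : has_degree (p one) m by split=> //; exact: p_m.
(* p 1 is equally a coefficient of C_{V,U}^1 C_{U,W}^1, so (A4) gives a(C_{V,W}^1) = m for every W.
   This is what later links different columns. *)
have := has_degree_cell V U W k1; rewrite -pE => /(has_degree_uniq h1) <-.
split=> // c; case: (c =P one) => [->|ne_c]; last first.
  by apply/eqP; apply: contraT => /only_one.
rewrite (has_degree_uniq h1 (has_degree_cell V U V k1)).
exact: degD.2.
Qed.

Let column_deg S b c W :
  deg_le (sc (cidx S b U) (cidx U one V) (cidx S c V)) (a (cidx V one W)).
Proof.
rewrite sc_p => k lt_k; rewrite lcoef_sum big1 // => e _.
by rewrite lcoef_intrM ((p_lead W).1 e _ lt_k) mul0r.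
Qed.

Let column_top S b c W :
  lcoef (sc (cidx S b U) (cidx U one V) (cidx S c V)) (a (cidx V one W)) =
  (c == b)%:R.
Proof.
rewrite sc_p lcoef_sum -(inj_eq (inv_inj (tbarBK (T l)))) -(kappa_1l (T l)).
rewrite -[RHS](sum_seq_delta d_uniq d_full (V := int^o)
  (fun e => kappa (T l) (bar c) e (bar b)) one).
by apply: eq_bigr => e _; rewrite lcoef_intrM (p_lead W).2 eq_sym.
Qed.

Lemma column_a S c W : a (cidx S c V) = a (cidx V one W).
Proof.
have k_nz : kappa (T l) c c one != 0 by rewrite kappa_1r eqxx.
apply: has_degree_uniq (has_degree_cell S U V k_nz) _; split.
  by rewrite column_top eqxx.
exact: column_deg.
Qed.

Lemma column_gamma S b c :
  gamma a (cidx S b U) (cidx U one V) (cidx S c V) = (c == b)%:R.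
Proof. by rewrite /gamma (column_a S c V) column_top. Qed.

End Column.

(** By [column_a] the value depends on the right index alone, and for right index U it equals
    a(C_{U,W}^1) for any W. The element C_{U',U}^1 can be read through its right index U or its left
    index U', which joins the two columns. *)
Lemma cell_a (S U S' U' : M l) b b' : a (cidx S b U) = a (cidx S' b' U').
Proof.
have [d d_uniq d_full] := cell_enum S.
have e (S1 U1 V1 : M l) c1 := column_a U1 V1 d_uniq d_full S1 c1.
by rewrite (e S U U b U) -(e U' U U one U) (e S' U' U' b' U).
Qed.

(** [left_coef] reduces the right factor to C_{U,V}^1. As a is constant on the cell, all terms are
    compared at the same power of v, and [column_gamma] leaves only c = b. *)
Lemma cell_gamma (S U V : M l) b b' b'' :
  gamma a (cidx S b U) (cidx U b' V) (cidx S b'' V) = kappa (T l) b'' b b'.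
Proof.
have [d d_uniq d_full] := cell_enum S.
rewrite /gamma /struct_const (left_coef U S V V V b' b'' _ d_uniq d_full).
rewrite eqxx mulr1n lcoef_sum.
under eq_bigr => c _ do
  rewrite lcoef_intrM (cell_a S V S V b'' c) -[lcoef _ _]/(gamma a _ _ _)
    (column_gamma U V d_uniq d_full) eq_sym.
exact: (sum_seq_delta d_uniq d_full (V := int^o) (fun c => kappa (T l) b'' c b') b).
Qed.

End Cell.

(** * Matrix units tensored with Gamma(l) *)

Local Notation cell l := (M l * B l * M l)%type.
Local Notation tg l := (@Tagged L l (fun l => cell l)).

Lemma cell_seq l : exists2 d : seq (cell l), uniq d & forall k, k \in d.
Proof.
apply: (full_seq_inj s_full (f := fun k => tg l k : X)) => i j /eqP.
by rewrite eq_Tagged => /eqP.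
Qed.

Lemma gamma_tags x y z : gamma a x y z != 0 -> tag x = tag z /\ tag y = tag z.
Proof. by move/gamma_neq0 => [l [S [U [V [b [b' [b'' [-> -> -> _]]]]]]]]. Qed.

Definition block (l : L) : alg int :=
  tensor (id : int -> int) (matrix_alg #|M l|) (int_alg (G l)).

Lemma block_bilinear l : bilinear_amul (block l).
Proof. exact: tensor_bilinear (matrix_bilinear _) (int_alg_bilinear _). Qed.

Definition block_unit l (k : cell l) : block l :=
  tens id (delta_mx (enum_rank k.1.1) (enum_rank k.2) : matrix_alg _)
    (T l k.1.2 : int_alg _).

Lemma block_dual l (d : seq (cell l)) : uniq d -> (forall k, k \in d) ->
  exists2 p : cell l -> {linear block l -> int^o},
    dual_family d (@block_unit l) p &
    forall i j k, p k (amul (block_unit i) (block_unit j)) =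
      gamma a (tg l i) (tg l j) (tg l k).
Proof.
move=> d_uniq d_full.
have p_ex (k : cell l) : exists p : {linear block l -> int^o},
    forall (m : matrix_alg #|M l|) (g : int_alg (G l)),
    p (tens id m g) = (m : 'M_#|M l|) (enum_rank k.1.1) (enum_rank k.2) *
      coef (T l) k.1.2 g.
  apply: (@tensor_lift _ _ id (matrix_alg #|M l|) (int_alg (G l)) int^o
    (fun m g => (m : 'M_#|M l|) (enum_rank k.1.1) (enum_rank k.2) *
      coef (T l) k.1.2 g)) => [m m' g|m g g'|c m g|c m g].
  - by rewrite mxE mulrDl.
  - by rewrite basis_coefD mulrDr.
  - by rewrite mxE; exact: (esym (mulrA c _ _)).
  - by rewrite basis_coefZ; exact: mulrCA.
pose p k := projT1 (cid (p_ex k)).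
have pE k m g : p k (tens id m g) =
    (m : 'M_#|M l|) (enum_rank k.1.1) (enum_rank k.2) * coef (T l) k.1.2 g.
  exact: (projT2 (cid (p_ex k))).
exists p.
  apply: dual_family_gen => // [[[S b] U] [[S' b'] U']|P P0 PD PZ Py v].
    rewrite /block_unit pE /= mxE coef_basis !(inj_eq enum_rank_inj).
    rewrite !xpair_eqE.
    by case: (S == S'); case: (b == b'); case: (U == U'); rewrite //= ?mulr0 ?mulr1.
  elim/tensor_ind: v => // m g.
  rewrite -(bcoordK (T l) g) (matrix_sum_delta (m : 'M_#|M l|)) /lincomb.
  rewrite tens_suml; apply: big_ind => // i _.
  rewrite tens_suml; apply: big_ind => // j _.
  rewrite tens_sumr; apply: big_ind => // b _.
  rewrite tensZr -!tensZl; apply: (PZ _ _ (PZ _ _ _)).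
  have := Py (enum_val i, b, enum_val j).
  by rewrite /block_unit /= !enum_valK.
move=> [[S1 b1] U1] [[S2 b2] U2] [[S b] U].
rewrite /block_unit (amul_tens _ (matrix_bilinear _) (int_alg_bilinear _)) pE /=.
rewrite [X in X * _](_ : _ =
    ((S == S1) && (U == U2))%:R *+ (U1 == S2)); last first.
  rewrite /amul /= mul_delta_mx_cond (inj_eq enum_rank_inj).
  case: (U1 == S2); last by rewrite !mulr0n mxE.
  by rewrite !mulr1n mxE !(inj_eq enum_rank_inj).
rewrite [coef _ _ _]/(kappa (T l) b b1 b2).
(* When gamma vanishes, either the matrix units do not compose to the unit (S, U), or the indices
   match and [cell_gamma] makes kappa vanish. *)
have [g0|gn0] := eqVneq (gamma a (cidx S1 b1 U1) (cidx S2 b2 U2) (cidx S b U)) 0.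
  rewrite [RHS]g0; case: (U1 =P S2) => [eU|_]; last by rewrite mulr0n mul0r.
  case: (S =P S1) => [eS|_]; last by rewrite /= mul0rn mul0r.
  case: (U =P U2) => [eU2|_]; last by rewrite /= mul0rn mul0r.
  by rewrite mulr1n mul1r -[LHS](cell_gamma S1 U1 U2) -g0 eU eS eU2.
have [-> -> -> _] := cell_gammaP gn0.
rewrite !eqxx /= mulr1n mul1r; exact: (esym (cell_gamma _ _ _ _ _ _)).
Qed.

(** * The asymptotic algebra of a cell *)

Local Notation vminus l := (@cell_vminus _ _ _ _ a l).

Lemma coef_chat z c : coef C z (lincomb (chat a) c) = c@_z * vpow (- a z).
Proof.
rewrite /lincomb basis_coef_sum.
under eq_bigr => i _ do rewrite /chat !basis_coefZ coef_basis.
case: msuppP => h.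
  rewrite (bigD1_seq z) ?fset_uniq //= eqxx mulr1 big1 ?addr0 // => i.
  by rewrite eq_sym => /negbTE ->; rewrite !mulr0.
rewrite mul0r big1_seq // => i /= hi; case: eqP => [eq_z|]; last by rewrite !mulr0.
by rewrite eq_z hi in h.
Qed.

(** Coordinates on the rescaled elements are v^(a z) times those on C, whence the bound - a z. *)
Lemma cell_minusP l (x : A) : x \in cell_minus a l <->
  (forall z, tag z != l -> coef C z x = 0) /\
  (forall z, deg_le (coef C z x) (- a z)).
Proof.
split=> [/asboolP[c [Sc Pc ->]]|[out deg]].
  split=> z; rewrite coef_chat.
    move=> ne_z; have [->|/Pc] := eqVneq c@_z 0; first by rewrite mul0r.
    by move/eqP; rewrite (negbTE ne_z).
  have dz : deg_le (vpow (- a z)) (- a z).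
    by move=> m lt_m; rewrite lcoef_vpow (lt_eqF lt_m).
  by have := deg_leM (Sc z : deg_le _ 0) dz; rewrite add0r.
apply/asboolP; pose c : {malg laurent[X]} := \sum_(i <- s) << vpow (a i) * coef C i x *g i >>.
have cE z : c@_z = vpow (a z) * coef C z x.
  rewrite /c raddf_sum (bigD1_seq z) //= mcoeffUU big1 ?addr0 // => i ne_i.
  by rewrite mcoeffU (negbTE ne_i) mulr0n.
exists c; split=> [i m lt_m|i|].
- rewrite cE lcoef_vpowM deg // -[X in X < _]add0r.
  by rewrite ltrD2r.
- rewrite cE; have [//|/out ->] := eqVneq (tag i) l.
  by rewrite mulr0 eqxx.
- apply: (@basis_ext _ _ _ C) => i.
  by rewrite coef_chat cE mulrC mulrA vpowNK mul1r.
Qed.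

(** The class of x in A_l^oo is thus read off the coefficients of v^(- a z). If all of them vanish,
    every degree bound drops by one and v x still lies in A_l^-. *)
Lemma cell_vminusP l (x : cell_minus_type a l) : x \in vminus l <->
  forall z, lcoef (coef C z x) (- a z) = 0.
Proof.
split=> [/asboolP[y ->] z|x0].
  rewrite basis_coefZ lcoef_vpowM; have [_ ->] := (cell_minusP l y).1 (cell_valP y) => //.
  by rewrite opprK ltrDl.
have [out deg] := (cell_minusP l x).1 (cell_valP x).
have y_minus : vpow 1 *: (x : A) \in cell_minus a l.
  apply/cell_minusP; split=> z; rewrite basis_coefZ; first by move/out ->; rewrite mulr0.
  move=> m lt_m; rewrite lcoef_vpowM.
  have [<-|lt_m'] := eqVneq (- a z) (m - 1); first exact: x0.
  apply: deg; rewrite lt_neqAle lt_m' /=.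
  by rewrite lerBrDr -ltzD1 ltrD2r.
apply/asboolP; exists (CellMinus y_minus) => /=.
by rewrite scalerA vpowNK scale1r.
Qed.

Lemma coef_cell_proj l z (x : A) :
  coef C z (cell_proj D l x) = if tag z == l then coef C z x else 0.
Proof.
rewrite /cell_proj basis_coef_sum big_mkcond /=.
under eq_bigr => i _ do rewrite basis_coefZ coef_basis.
rewrite [in RHS]/coef; case: msuppP => h; last first.
  rewrite if_same big1_seq // => i /= hi; case: ifP => // _.
  by case: eqP => [eq_z|]; [rewrite eq_z hi in h|rewrite mulr0].
rewrite (bigD1_seq z) ?fset_uniq //= eqxx mulr1 big1 ?addr0 // => i.
by rewrite eq_sym => /negbTE ->; rewrite mulr0 if_same.
Qed.

Lemma coef_amul z (x y : A) : coef C z (amul x y) =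
  \sum_(i <- s) \sum_(j <- s) coef C i x * coef C j y * sc i j z.
Proof.
rewrite {1}(coef_sum_basis C x s_uniq s_full) {1}(coef_sum_basis C y s_uniq s_full).
rewrite (amul_suml tabular_bilinear) basis_coef_sum; apply: eq_bigr => i _.
rewrite (amul_sumr tabular_bilinear) basis_coef_sum; apply: eq_bigr => j _.
rewrite (amulZl tabular_bilinear) (amulZr tabular_bilinear) !basis_coefZ.
by rewrite mulrA.
Qed.

Lemma cell_a_tag x y : tag x = tag y -> a x = a y.
Proof.
case: x y => [l [[S b] U]] [l' [[S' b'] U']] /= el; subst l'.
exact: (cell_a S U S' U' b b').
Qed.

(** Constancy of a on the cell gives - a z = - a i - a j + a z, the sum of the bounds for the three
    factors, so leading coefficients multiply. The degree bound is the closure of A_l^- under the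
    product. *)
Lemma cell_mul_top l (x y : A) z : x \in cell_minus a l -> y \in cell_minus a l ->
  tag z = l -> deg_le (coef C z (amul x y)) (- a z) /\
  lcoef (coef C z (amul x y)) (- a z) =
  \sum_(i <- s) \sum_(j <- s)
    lcoef (coef C i x) (- a i) * lcoef (coef C j y) (- a j) * gamma a i j z.
Proof.
move=> /cell_minusP[outx degx] /cell_minusP[outy degy] tz.
have term i j :
    deg_le (coef C i x * coef C j y * sc i j z) (- a z) /\
    lcoef (coef C i x * coef C j y * sc i j z) (- a z) =
      lcoef (coef C i x) (- a i) * lcoef (coef C j y) (- a j) * gamma a i j z.
  have [ti|/outx ->] := eqVneq (tag i) l; last first.
    by rewrite !mul0r !lcoef0 !mul0r; split=> // m _; rewrite lcoef0.
  have [tj|/outy ->] := eqVneq (tag j) l; last first.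
    by rewrite !(mulr0, mul0r) !lcoef0 !(mulr0, mul0r); split=> // m _; rewrite lcoef0.
  have eD : - a z = - a i + - a j + a z.
    by rewrite (@cell_a_tag i z) ?ti // (@cell_a_tag j z) ?tj // subrK.
  rewrite {1 2}eD; split.
    exact: deg_leM (deg_leM (degx i) (degy j)) (@struct_const_deg i j z).
  rewrite (lcoefM_top (deg_leM (degx i) (degy j)) (@struct_const_deg i j z)).
  by rewrite (lcoefM_top (degx i) (degy j)).
rewrite coef_amul; split=> [m lt_m|].
  rewrite lcoef_sum big1 // => i _; rewrite lcoef_sum big1 // => j _.
  exact: (term i j).1.
rewrite lcoef_sum; apply: eq_bigr => i _; rewrite lcoef_sum.
by apply: eq_bigr => j _; rewrite (term i j).2.
Qed.

(** Closure of A_l^- excludes the default value of [insubd]. *)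
Lemma cell_minus_mulE l (x y : cell_minus_type a l) :
  (cell_minus_mul x y : A) = cell_proj D l (amul (x : A) (y : A)).
Proof.
rewrite /cell_minus_mul; apply: insubdK; apply/cell_minusP; split=> z.
  by rewrite coef_cell_proj => /negbTE ->.
rewrite coef_cell_proj; case: eqP => [tz|_]; last by move=> m _; rewrite lcoef0.
exact: (cell_mul_top (cell_valP x) (cell_valP y) tz).1.
Qed.

Lemma asym_cell_iso l : alg_iso (asym_cell a l) (block l).
Proof.
have [d d_uniq d_full] := cell_seq l.
have [p dual_p pM] := block_dual d_uniq d_full.
pose lead (x : A) (i : X) := lcoef (coef C i x) (- a i).
have leadD x y i : lead (x + y) i = lead x i + lead y i.
  by rewrite /lead basis_coefD lcoefD.
(* Restricted to A_l^-, F is multiplicative with kernel v^-1 A_l^-, so it induces the isomorphism on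
   the quotient. *)
pose F (x : A) : block l := \sum_(k <- d) lead x (tg l k) *: block_unit k.
have FD x y : F (x + y) = F x + F y.
  by rewrite /F -big_split; apply: eq_bigr => k _; rewrite leadD scalerDl.
have F0 : F 0 = 0 by apply: (addrI (F 0)); rewrite -FD !addr0.
have FN x : F (- x) = - F x by apply: (addrI (F x)); rewrite -FD !subrr F0.
have pF k x : p k (F x) = lead x (tg l k).
  rewrite linear_sum -[RHS](sum_seq_delta d_uniq d_full (V := int^o)
    (fun j => lead x (tg l j)) k).
  apply: eq_bigr => j _; rewrite linearZ_LR /= (dual_p.1 k j); exact: mulrC.
have pZ k c w : p k (c *: w) = c * p k w by rewrite linearZ_LR.
have lead_out x i : x \in cell_minus a l -> tag i != l -> lead x i = 0.
  by move=> /cell_minusP[out _] /out; rewrite /lead => ->; exact: lcoef0.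
have F_eq0 (x : cell_minus_type a l) : F x = 0 -> x \in vminus l.
  move=> Fx0; apply/cell_vminusP => z; rewrite -/(lead x z).
  have [tz|] := eqVneq (tag z) l; last exact: lead_out (cell_valP x).
  by case: z tz => l' k /= el; subst l'; rewrite -pF Fx0 linear0.
have F_vminus (x : cell_minus_type a l) : x \in vminus l -> F x = 0.
  move/cell_vminusP => x0; rewrite /F big1 // => k _.
  by rewrite /lead x0 scale0r.
have sum_cell (f : X -> int) : (forall i, tag i != l -> f i = 0) ->
    \sum_(i <- s) f i = \sum_(k <- d) f (tg l k).
  move=> f_out; apply: (sum_seq_reindex s_uniq s_full (f := fun k => tg l k : X)) => //.
    by move=> i j /eqP; rewrite eq_Tagged => /eqP.
  move=> i fi; have ti : tag i = l by apply/eqP; apply: contraNT fi => /f_out ->.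
  by case: i ti fi => l' k /= el; subst l'; exists k.
have FM (x y : cell_minus_type a l) : F (cell_minus_mul x y) = amul (F x) (F y).
  apply: (dual_family_ext dual_p) => k; rewrite pF cell_minus_mulE.
  rewrite /lead coef_cell_proj ifT; last exact: eqxx.
  rewrite (cell_mul_top (z := tg l k) (cell_valP x) (cell_valP y) erefl).2.
  rewrite sum_cell => [|i ti]; last first.
    apply: big1 => j _; rewrite -/(lead x i).
    by rewrite (lead_out _ _ (cell_valP x) ti) !mul0r.
  rewrite {1}/F (amul_suml (block_bilinear l)) linear_sum; apply: eq_bigr => i _.
  rewrite sum_cell => [|j tj]; last first.
    by rewrite -/(lead y j) (lead_out _ _ (cell_valP y) tj) mulr0 mul0r.
  rewrite /F (amul_sumr (block_bilinear l)) linear_sum; apply: eq_bigr => j _.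
  rewrite (amulZl (block_bilinear l)) (amulZr (block_bilinear l)).
  by rewrite !pZ pM mulrA.
have F_repr (x : cell_minus_type a l) :
    F (repr (\pi_{ideal_quot (vminus l)} x)) = F x.
  apply: subr0_eq; rewrite -FN -FD.
  apply: (F_vminus (repr (\pi_{ideal_quot (vminus l)} x) - x)).
  by rewrite Quotient.idealrBE reprK.
pose f (q : {ideal_quot (vminus l)}) : block l := F (repr q).
have fD : {morph (f : asym_cell a l -> block l) : q r / q + r}.
  move=> q r; rewrite /f -[in LHS](reprK (q : {ideal_quot (vminus l)})).
  rewrite -[in LHS](reprK (r : {ideal_quot (vminus l)})).
  by rewrite -(raddfD \pi_({ideal_quot (vminus l)})) F_repr FD.
have [g gE] := linear_exists (additive_int_linear fD); exists g; split; last first.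
  move=> q r; rewrite gE (gE q) (gE r).
  have -> : amul q r = \pi_({ideal_quot (vminus l)}) (cell_minus_mul
      (repr (q : {ideal_quot (vminus l)})) (repr (r : {ideal_quot (vminus l)}))).
    by rewrite /amul /= -lock.
  by rewrite /f F_repr FM.
apply: (eq_bij (f := f)); last by move=> q; rewrite gE.
apply: inj_surj_bij => [q r eq_f|w].
  rewrite -[q]reprK -[r]reprK; apply/eqP; rewrite -Quotient.idealrBE.
  by apply: F_eq0; rewrite FD FN -/(f q) -/(f r) eq_f subrr.
(* A preimage of w: the combination of the rescaled elements with the integer coordinates of w. *)
pose c : {malg laurent[X]} := \sum_(k <- d) << (p k w)%:~R *g tg l k >>.
have cE z : c@_z = \sum_(k <- d) (p k w)%:~R *+ (tg l k == z).
  by rewrite /c raddf_sum; apply: eq_bigr => k _; rewrite /= mcoeffU.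
have lcoefc z m : lcoef c@_z m = \sum_(k <- d) (lcoef 1 m * p k w) *+ (tg l k == z).
  rewrite cE lcoef_sum; apply: eq_bigr => k _.
  by case: eqP => _; rewrite ?mulr0n ?lcoef0 // !mulr1n -[_%:~R]mul1r lcoef_intrM.
have u_minus : lincomb (chat a) c \in cell_minus a l.
  apply/asboolP; exists c; split=> // [i m lt_m|i].
    rewrite lcoefc big1 // => k _; rewrite -vpow0 lcoef_vpow (lt_eqF lt_m).
    by rewrite mul0r mul0rn.
  rewrite cE; apply: contraNeq => ti; rewrite big1 // => k _.
  by case: (tg l k =P i) ti => [<- /eqP []|_ _]; last by rewrite mulr0n.
exists (\pi_{ideal_quot (vminus l)} (CellMinus u_minus)).
rewrite /f F_repr; apply: (dual_family_ext dual_p) => k; rewrite pF /lead /=.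
rewrite coef_chat mulrC lcoef_vpowM subrr lcoefc.
rewrite -[RHS](sum_seq_delta d_uniq d_full (V := int^o) (fun j => p j w) k).
apply: eq_bigr => j _; rewrite -vpow0 lcoef_vpow eqxx mul1r eq_Tagged /= eq_sym.
by rewrite -mulr_natl.
Qed.

(** * Lusztig's homomorphism *)

Definition col_unit (z : X) : X :=
  let: existT l (_, _, U) := z in cidx U (tone (T l)) U.

(* The z-coordinate of Lusztig's homomorphism into the asymptotic algebra; the
   elements C (col_unit z) = C_{U,U}^1 play the part of the distinguished
   involutions. *)
Definition lusztig (x : A) (z : X) : laurent :=
  coef C z (amul x (C (col_unit z))).

(** On the span of a cell, modulo lower cells, x acts as left multiplication by its Lusztig image
    for the asymptotic product: [left_coef] expresses the action through x C_{S',S'}^1, and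
    [cell_gamma] recognizes kappa as gamma. *)
Lemma coef_amul_C x w z : tag w = tag z ->
  coef C z (amul x (C w)) =
  \sum_(u <- s) lusztig x u * (gamma a u w z)%:~R.
Proof.
case: w z => [l [[S' b'] U']] [l' [[S b] U]] /= el; subst l'.
have [d d_uniq d_full] := cell_enum S.
rewrite (left_coef S' S U' U S' b' b x d_uniq d_full).
rewrite (sum_seq_reindex (d := d) (f := fun c => cidx S c S') s_uniq s_full) //.
- case: (U =P U') => [->|ne_U].
    rewrite mulr1n; apply: eq_bigr => c _.
    by rewrite -(cell_gamma S S' U').
  rewrite mulr0n big1 // => c _.
  have [g0|gn0] := eqVneq (gamma a (cidx S c S') (cidx S' b' U') (cidx S b U)) 0.
    by rewrite [gamma _ _ _ _]g0 mulr0.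
  by have [_ _ eU _] := cell_gammaP gn0; case: ne_U.
- by move=> c c' /eqP; rewrite cidx_inj => /and3P[_ /eqP].
move=> u nz; have : gamma a u (cidx S' b' U') (cidx S b U) != 0.
  by apply: contraNneq nz => g0; rewrite [gamma _ _ _ _]g0 mulr0.
move/gamma_neq0 => [l' [S1 [U1 [V1 [c [c' [c'' [-> e2 e3 _]]]]]]]].
have el := cidx_tag_inj e2; subst l'.
move/eqP: e2; rewrite cidx_inj => /and3P[/eqP <- _ _].
move/eqP: e3; rewrite cidx_inj => /and3P[/eqP <- _ _].
by exists c.
Qed.

Lemma gamma_col u w z : gamma a u w z != 0 -> col_unit w = col_unit z.
Proof.
by move/gamma_neq0 => [l [S [U [V [b [b' [b'' [_ -> -> _]]]]]]]].
Qed.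

Lemma tag_col_unit z : tag (col_unit z) = tag z.
Proof. by case: z => l [[S b] U]. Qed.

(** Expand y C_{U,U}^1 over the w and apply x. Since left multiplication never leads upwards in the
    order of cells, w contributes to z only if its cell is both below and above that of z;
    antisymmetry leaves the cell of z, where [coef_amul_C] applies. *)
Lemma lusztigM x y z : lusztig (amul x y) z =
  \sum_(u <- s) \sum_(w <- s)
    lusztig x u * lusztig y w * (gamma a u w z)%:~R.
Proof.
have -> : lusztig (amul x y) z =
    \sum_(w <- s) coef C w (amul y (C (col_unit z))) * coef C z (amul x (C w)).
  rewrite /lusztig; case: tabD => [[amulA _ _ _ _] _ _ _]; rewrite -amulA.
  rewrite {1}(coef_sum_basis C (amul y _) s_uniq s_full).
  rewrite (amul_sumr tabular_bilinear) basis_coef_sum; apply: eq_bigr => w _.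
  by rewrite (amulZr tabular_bilinear) basis_coefZ.
rewrite exchange_big; apply: eq_bigr => w _ /=.
have [tw|ne_t] := eqVneq (tag w) (tag z).
  rewrite (coef_amul_C x tw) mulr_sumr; apply: eq_bigr => u _.
  (* If gamma is nonzero, w and z share their right index, so the coefficient of w in y C_{U,U}^1 is
     [lusztig y w]. *)
  have [->|/gamma_col e] := eqVneq (gamma a u w z) 0; first by rewrite !mulr0.
  by rewrite -e -/(lusztig y w) mulrA (mulrC (lusztig y w)).
rewrite [RHS]big1 => [|u _]; last first.
  have [->|/gamma_tags[_ e]] := eqVneq (gamma a u w z) 0; first by rewrite mulr0.
  by rewrite e eqxx in ne_t.
have [->|] := eqVneq (coef C w (amul y (C (col_unit z)))) 0; first by rewrite mul0r.
move/left_coef_le; rewrite tag_col_unit => le_wz.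
have [->|/left_coef_le le_zw] := eqVneq (coef C z (amul x (C w))) 0.
  by rewrite mulr0.
by case/eqP: ne_t; apply/le_anti; rewrite le_wz le_zw.
Qed.

Lemma lusztigD x y z : lusztig (x + y) z = lusztig x z + lusztig y z.
Proof. by rewrite /lusztig (amulDl tabular_bilinear) basis_coefD. Qed.

Lemma lusztigZ c x z : lusztig (c *: x) z = c * lusztig x z.
Proof. by rewrite /lusztig (amulZl tabular_bilinear) basis_coefZ. Qed.

Lemma lusztig_deg x z : deg_le (lusztig (C x) z) (a z).
Proof. exact: struct_const_deg. Qed.

(** The coefficient is gamma at x, C_{U,U}^1 and z, and t for C_{U,U}^1 is a right identity on
    elements of right index U. So the leading part of Lusztig's matrix is the identity. *)
Lemma lusztig_top x z : lcoef (lusztig (C x) z) (a z) = (x == z)%:R.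
Proof.
rewrite -[LHS]/(gamma a x (col_unit z) z); case: (x =P z) => [->|ne_x].
  by case: z => l [[S b] U]; rewrite cell_gamma kappa_1r eqxx.
apply/eqP; apply: contraT => /gamma_neq0.
move=> [l [S [U [V [b [b' [b'' [ex ey ez]]]]]]]]; subst z.
move/eqP: ey; rewrite cidx_inj => /and3P[/eqP eV /eqP eb _].
rewrite -eb kappa_1r; case: (b'' =P b) => // e.
by case: ne_x; rewrite ex e eV.
Qed.

Lemma dsum_block_bilinear : bilinear_amul (dsum block).
Proof. exact: dsum_bilinear block_bilinear. Qed.

Definition asym_unit : X -> dsum block := dsum_family block_unit.

(** Within a cell this is [block_dual]; when the cells differ, the product in the direct sum and
    gamma both vanish. *)
Lemma asym_dual : exists2 q : X -> {linear dsum block -> int^o},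
  dual_family s asym_unit q &
  forall i j k, q k (amul (asym_unit i) (asym_unit j)) = gamma a i j k.
Proof.
have dp_ex l : exists dp : seq (cell l) * (cell l -> {linear block l -> int^o}),
    dual_family dp.1 (@block_unit l) dp.2 /\
    forall i j k, dp.2 k (amul (block_unit i) (block_unit j)) =
      gamma a (tg l i) (tg l j) (tg l k).
  have [d d_uniq d_full] := cell_seq l.
  by have [p dual_p pM] := block_dual d_uniq d_full; exists (d, p).
pose p l := (projT1 (cid (dp_ex l))).2.
have dual_p l := proj1 (projT2 (cid (dp_ex l))).
have pM l : forall i j k, p l k (amul (block_unit i) (block_unit j)) =
    gamma a (tg l i) (tg l j) (tg l k).
  exact: (proj2 (projT2 (cid (dp_ex l)))).
have [q dual_q qE] := dsum_dual (p := p) s_uniq s_full dual_p.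
exists q => // i j k; rewrite qE dsum_coordM.
have out x : tag x != tag k -> dsum_coord (tag k) (asym_unit x) = 0.
  by move=> ne; rewrite /asym_unit /dsum_family dsum_coord_inj_neq.
have [ti|ne_i] := eqVneq (tag i) (tag k); last first.
  rewrite (out i ne_i) (amul0l (block_bilinear _)) linear0.
  by apply/esym/eqP; apply: contraNT ne_i => /gamma_tags[-> _].
have [tj|ne_j] := eqVneq (tag j) (tag k); last first.
  rewrite (out j ne_j) (amul0r (block_bilinear _)) linear0.
  by apply/esym/eqP; apply: contraNT ne_j => /gamma_tags[_ ->].
case: i j k ti tj {out} => [l i] [l' j] [l'' k] ti tj.
have {}ti : l = l'' := ti; have {}tj : l' = l'' := tj; subst l l'.
have inE l0 (u : cell l0) : dsum_coord l0 (asym_unit (tg l0 u)) = block_unit u.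
  exact: dsum_coord_inj.
exact: (etrans (congr2 (fun u v => p l'' k (amul u v)) (inE l'' i) (inE l'' j))
  (pM l'' i j k)).
Qed.

Local Notation Qk := (regular_alg Qv).
Local Notation kA := (tensor laurent_Qv Qk A).
Local Notation kY := (tensor intr Qk (dsum block)).

Lemma kA_gen (v : kA) : exists c : X -> Qv,
  v = \sum_(x <- s) c x *: tens laurent_Qv (1 : Qk) (C x).
Proof.
elim/tensor_ind: v => [|u v [c cE] [d dE]|t x].
- by exists (fun=> 0); rewrite big1 // => x _; rewrite scale0r.
- exists (fun x => c x + d x); rewrite cE dE -big_split.
  by apply: eq_bigr => x _; rewrite scalerDl.
exists (fun y => laurent_Qv (coef C y x) * t).
rewrite {1}(coef_sum_basis C x s_uniq s_full) tens_sumr.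
apply: eq_bigr => y _; rewrite tensZr tensZl.
have e (b : Qv) : b *: (t : Qk) = (b * t) *: (1 : Qk) := esym (mulr1 _).
by rewrite e.
Qed.

(** The target is the sum of the blocks, where coordinates are explicit functionals; part (i) then
    replaces it by k (x) A^oo. *)
Lemma ext_iso : alg_iso kA kY.
Proof.
have [q dual_q qM] := asym_dual.
have [r dual_r rE] := ext_dual Qv s_uniq s_full dual_q.
have bQ := regular_bilinear Qv; have bY := dsum_block_bilinear.
have bkY : bilinear_amul kY by exact: tensor_bilinear.
pose y : X -> kY := ext_family Qv asym_unit.
have rM i j k : r k (amul (y i) (y j)) = (gamma a i j k)%:~R.
  by rewrite /y /ext_family (amul_tens _ bQ bY) rE qM /amul /= !mulr1 mul1r.
have rZ k c v : r k (c *: v) = c * r k v by rewrite linearZ_LR.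
pose phi (x : A) : kY := \sum_(z <- s) laurent_Qv (lusztig x z) *: y z.
have r_phi x z : r z (phi x) = laurent_Qv (lusztig x z).
  rewrite linear_sum -[RHS](sum_seq_delta s_uniq s_full (V := Qv^o)
    (fun z => laurent_Qv (lusztig x z)) z).
  by apply: eq_bigr => w _; rewrite rZ dual_r.1 mulrC.
have phiD u v : phi (u + v) = phi u + phi v.
  rewrite -big_split; apply: eq_bigr => z _.
  by rewrite lusztigD raddfD scalerDl.
have phiZ c u : phi (c *: u) = laurent_Qv c *: phi u.
  rewrite scaler_sumr; apply: eq_bigr => z _.
  by rewrite lusztigZ rmorphM scalerA.
have phiM u v : phi (amul u v) = amul (phi u) (phi v).
  apply: (dual_family_ext dual_r) => k; rewrite r_phi lusztigM rmorph_sum.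
  rewrite (amul_suml bkY) linear_sum; apply: eq_bigr => i _.
  rewrite rmorph_sum (amul_sumr bkY) linear_sum; apply: eq_bigr => j _.
  by rewrite (amulZl bkY) (amulZr bkY) !rZ rM !rmorphM rmorph_int mulrA.
have [f fE] : exists f : {linear kA -> kY},
    forall (c : Qk) u, f (tens laurent_Qv c u) = (c : Qv) *: phi u.
  apply: (@tensor_lift _ _ laurent_Qv Qk A kY (fun c u => (c : Qv) *: phi u)).
  - by move=> c d u; rewrite scalerDl.
  - by move=> c u v; rewrite phiD scalerDr.
  - by move=> t c u; rewrite scalerA.
  - by move=> t c u; rewrite phiZ !scalerA mulrC.
exists f; split; last first.
  have fM (c d : Qv) u v :
      (c * d) *: phi (amul u v) = amul (c *: phi u) (d *: phi v).
    by rewrite phiM (amulZl bkY) (amulZr bkY) scalerA.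
  apply: (tensor_morph bQ tabular_bilinear bkY) => c d u v.
  exact: (etrans (fE (amul c d) (amul u v)) (etrans (fM c d u v)
    (esym (congr2 (@amul _ kY) (fE c u) (fE d v))))).
apply: (linear_bij (y := y) (q := r) _ s_uniq kA_gen dual_r.2).
  by move=> x; exact: linearP.
set H := \matrix_(i, j) _.
(* Column z has degree bound a(z), attained only on the diagonal and with coefficient 1. *)
rewrite (_ : H = map_mx laurent_Qv (\matrix_(i, j)
    lusztig (C (tnth (in_tuple s) i)) (tnth (in_tuple s) j))).
  apply: (det_laurent_Qv_neq0 (n := fun j => a (tnth (in_tuple s) j))) => i j.
    by rewrite mxE; exact: lusztig_deg.
  by rewrite mxE lusztig_top (inj_eq (elimT (tuple_uniqP (in_tuple s)) s_uniq)).
by apply/matrixP => i j; rewrite !mxE fE scale1r r_phi.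
Qed.

End TabularAlgebra.

(** * From the blocks back to the asymptotic algebra *)

Theorem theorem3p2p4 (disp : Order.disp_t) (L : finPOrderType disp)
    (A : alg laurent) (D : table_datum L A) (a : td_index D -> int) :
  tabular D -> is_a_function a -> with_trace a -> finite_rank A ->
  let k := regular_alg Qv in
  let block (l : L) : alg int :=
    tensor (id : int -> int) (matrix_alg #|tdM D l|) (int_alg (tdG D l)) in
  [/\ forall l : L, alg_iso (asym_cell a l) (block l),
      alg_iso (tensor laurent_Qv k A) (tensor intr k (asym a))
    & alg_iso (tensor intr k (asym a))
        (dsum (fun l : L => tensor intr k (block l)))].
Proof.
move=> tabD a_fun [degD _] finA k blk.
have [s s_uniq s_full] := finite_rank_index (tdC D) finA.
have iso_cell l : alg_iso (asym_cell a l) (blk l).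
  exact: (asym_cell_iso tabD a_fun degD s_uniq s_full).
have blk_bilinear l : bilinear_amul (blk l) by exact: block_bilinear.
have iso_asym : alg_iso (tensor intr k (asym a)) (tensor intr k (dsum blk)).
  apply: tensor_iso; [exact: regular_bilinear|exact: dsum_bilinear|].
  exact: dsum_iso.
split=> //.
  apply: alg_iso_trans (alg_iso_sym iso_asym).
  exact: (ext_iso tabD a_fun degD s_uniq s_full).
apply: alg_iso_trans iso_asym _.
by apply: tensor_dsum_iso => //; exact: regular_bilinear.
Qed.
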